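(* Let $b>0$, $a=\dfrac{1}{\ln\left(1+\frac{1}{2b}\right)}$, and let $(G_\sigma)_{\sigma\ge1}$ be the log-convolution semi-group of the inverse log-gamma distributions, i.e. $G_1=\varepsilon_1$ and, for $\sigma>1$, $G_\sigma$ has density $$g_\sigma(r)=\frac{b^{a\ln\sigma}}{\Gamma(a\ln\sigma)}(-\ln r)^{a\ln\sigma-1}r^{b-1},\qquad 0<r<1 .$$ Let $X$ be the associated process described in the context and $\nu(d\omega)=a\,\omega^{-1}e^{-b\omega}d\omega$ on $(0,\infty)$. Then for any bounded differentiable function $f:\mathbb{R}\to\mathbb{R}$ with bounded first derivative, any $s>0$ and any $x\in\mathbb{R}$, $$A_sf(x)=\frac{x}{2s}f'(x)+\frac{1}{2s}\int_{\mathbb{R}}\big[f(x+y)-f(x)\big]\int_0^{\infty}\phi\big((e^{-\omega/2}-1)x,\;s(1-e^{-\omega}),\;y\big)\,\nu(d\omega)\,dy .$$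
   Context: $\varepsilon_a$ denotes the Dirac measure at $a$; $\phi(\mu,v,\cdot)$ is the density of the Gaussian distribution with mean $\mu$ and variance $v$. A family $(G_\sigma)_{\sigma\ge1}$ of probability measures on $[0,1]$ is a log-convolution semi-group if, for all $\sigma,\tau\ge1$, the product of two independent random variables with distributions $G_\sigma$ and $G_\tau$ has distribution $G_{\sigma\tau}$. For $R_\sigma$ distributed as the inverse log-gamma law $G_\sigma$, $-\ln R_\sigma$ has a gamma distribution with density $\frac{b^{a\ln\sigma}}{\Gamma(a\ln\sigma)}u^{a\ln\sigma-1}e^{-bu}$, $u>0$, and $\mathbb{E}[(R_\sigma)^\lambda]=\sigma^{-\psi(\lambda)}$ with $\psi(\lambda)=a\ln(1+\lambda/b)$, so $\psi(1/2)=1$. $X$ is the Markov martingale with $X_0=0$ whose transition probabilities for $0<s<t$, with $\sigma=\sqrt{t/s}$, are $$P_{s,t}(x,dy)=\left(\int_{[0,1)}\phi\big(\sigma\sqrt r\,x,\;t(1-r),\;y\big)\,G_\sigma(dr)\right)dy,$$ and $P_{0,t}(x,dy)=\phi(x,t,y)\,dy$. The infinitesimal generator is $A_sf(x)=\lim_{t\downarrow s}\frac{1}{t-s}\left(\int f(y)P_{s,t}(x,dy)-f(x)\right)$. *)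

(* Defs.v *)
From HB Require Import structures.
From mathcomp Require Import all_boot all_order all_algebra.
From mathcomp Require Import all_classical all_reals all_analysis.
From mathcomp Require Import measurable_realfun.

Set Implicit Arguments.
Unset Strict Implicit.
Unset Printing Implicit Defensive.
Import Order.TTheory GRing.Theory Num.Theory.
Import numFieldNormedType.Exports.

Local Open Scope classical_set_scope.
Local Open Scope ring_scope.

Section density_measure.
Context {R : realType}.
Local Notation mu := (@lebesgue_measure R).

Definition density_measure (k : R -> \bar R) (k0 : forall x, (0 <= k x)%E)
    (mk : measurable_fun [set: R] k) : set (measurableTypeR R) -> \bar R :=
  fun A => (\int[mu]_(x in A) k x)%E.

Variables (k : R -> \bar R) (k0 : forall x, (0 <= k x)%E).
Variable (mk : measurable_fun [set: R] k).

Let density_measure0 : density_measure k0 mk set0 = 0%E.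
Proof. by rewrite /density_measure integral_set0. Qed.

Let density_measure_ge0 A : (0 <= density_measure k0 mk A)%E.
Proof. by apply: integral_ge0 => x _; exact: k0. Qed.

Let density_measure_sigma_additive :
  semi_sigma_additive (density_measure k0 mk).
Proof. exact: semi_sigma_additive_nng_induced. Qed.

HB.instance Definition _ := isMeasure.Build _ _ _ (density_measure k0 mk)
  density_measure0 density_measure_ge0 density_measure_sigma_additive.

Lemma density_measure_sigma_finite : (forall x, (k x < +oo)%E) ->
  sigma_finite setT (density_measure k0 mk).
Proof.
move=> kfin.
exists (fun n : nat => [set x | (k x <= n%:R%:E)%E] `&` `[- n%:R, n%:R]).
  apply/esym; rewrite -subTset => x _ /=.
  have kx : k x \is a fin_num by rewrite ge0_fin_numE ?kfin// k0.
  pose m := Num.max (fine (k x)) `|x|.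
  have m0 : 0 <= m by rewrite le_max normr_ge0 orbT.
  exists (Num.truncn m).+1 => //=.
  have /ltW h := truncnS_gt m.
  split => /=.
    rewrite -(fineK kx) lee_fin; apply: le_trans h.
    by rewrite le_max lexx.
  rewrite in_itv /= -ler_norml; apply: le_trans h.
  by rewrite le_max lexx orbT.
move=> n; split.
  apply: measurableI => //.
  by rewrite -[X in measurable X]setTI; exact: emeasurable_fun_infty_c.
rewrite /density_measure.
set A := _ `&` _.
have mA : measurable A.
  apply: measurableI => //.
  by rewrite -[X in measurable X]setTI; exact: emeasurable_fun_infty_c.
apply: (@le_lt_trans _ _ (\int[mu]_(x in A) (cst (n%:R%R : R)%:E) x)%E).
  apply: ge0_le_integral => //.
  - exact: measurable_funTS.
  - by move=> x [].
rewrite integral_cst//.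
have hA : (mu A <= mu `[(- n%:R)%R, n%:R%R]%classic)%E.
  by apply: le_measure; rewrite ?inE//; exact: subIsetr.
apply: lte_mul_pinfty => //.
apply: le_lt_trans hA _; rewrite lebesgue_measure_itv /=.
by case: ifP => _; rewrite -?EFinB ltry.
Qed.

End density_measure.

Section gaussian.
Context {R : realType}.

(* [v] is the variance, whereas [normal_pdf] takes the standard deviation.
   For [v <= 0] it is the conventional [normal_pdf m 0], with no meaning here. *)
Definition gauss_density (m v y : R) : R := normal_pdf m (Num.sqrt v) y.

Lemma measurable_gauss_density d (T : measurableType d) (m v y : T -> R) :
  measurable_fun setT m -> measurable_fun setT v -> measurable_fun setT y ->
  measurable_fun setT (fun t => gauss_density (m t) (v t) (y t)).
Proof.
move=> mm mv my.
have msqrt : measurable_fun [set: R] (@Num.sqrt R).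
  by apply: continuous_measurable_fun; exact: sqrt_continuous.
have minv (h : T -> R) : (forall t, 0 <= h t) -> measurable_fun setT h ->
    measurable_fun setT (fun t => (h t)^-1).
  move=> h0 mh.
  rewrite (_ : (fun _ => _) = (fun t => h t `^ (-1))); last first.
    by apply/funext => t; rewrite powR_inv1.
  exact: measurableT_comp (measurable_powR _) mh.
have ms : measurable_fun setT (fun t => Num.sqrt (v t)).
  exact: measurableT_comp.
rewrite /gauss_density /normal_pdf; apply: measurable_fun_ifT.
- by apply: (measurable_fun_eqr ms); exact: measurable_cst.
- apply: (measurableT_comp (f := (\1_`[0, 1]%classic : R -> R))) => //.
- apply: measurable_funM.
  + apply: minv => [t|]; first exact: sqrtr_ge0.
    apply: measurableT_comp => //.
    rewrite (_ : (fun _ => _) = (fun t => Num.sqrt (v t) ^+ 2 * (pi * 2))).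
      by apply: measurable_funM => //; exact: measurable_funX.
    by apply/funext => t; rewrite -mulr_natr mulrA.
  + apply: measurableT_comp => //; apply: measurable_funM.
      apply: measurableT_comp => //; apply: measurable_funX.
      exact: measurable_funB.
    apply: minv => [t|]; first by rewrite mulrn_wge0 ?sqr_ge0.
    rewrite (_ : (fun _ => _) = (fun t => Num.sqrt (v t) ^+ 2 * 2)).
      by apply: measurable_funM => //; exact: measurable_funX.
    by apply/funext => t; rewrite -mulr_natr.
Qed.

End gaussian.

Section loggamma.
Context {R : realType}.
Local Notation mu := (@lebesgue_measure R).

Definition Gamma (z : R) : R :=
  \int[mu]_(u in `]0, +oo[) (u `^ (z - 1) * expR (- u)).

(* The normalization [psi(1/2) = 1] of [psi(l) = a * ln (1 + l / b)]. *)
Definition loggamma_shape (b : R) : R := (ln (1 + (2 * b)^-1))^-1.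

Definition inv_loggamma_pdf (a b sigma r : R) : R :=
  b `^ (a * ln sigma) / Gamma (a * ln sigma) *
  (- ln r) `^ (a * ln sigma - 1) * r `^ (b - 1).

Lemma inv_loggamma_pdf_ge0 a b sigma r : 0 <= inv_loggamma_pdf a b sigma r.
Proof.
rewrite /inv_loggamma_pdf !mulr_ge0 ?powR_ge0// invr_ge0.
by apply: Rintegral_ge0 => u _; rewrite mulr_ge0 ?powR_ge0 ?expR_ge0.
Qed.

Lemma measurable_inv_loggamma_pdf a b sigma :
  measurable_fun setT (inv_loggamma_pdf a b sigma).
Proof.
apply: measurable_funM; last exact: measurable_powR.
apply: measurable_funM => //.
apply: (measurableT_comp (f := fun x : R => x `^ (a * ln sigma - 1))).
  exact: measurable_powR.
exact: measurableT_comp.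
Qed.

Definition levy_pdf (b w : R) : R :=
  loggamma_shape b * w^-1 * expR (- (b * w)).

Lemma levy_pdf_ge0 b w : 0 < b -> 0 < w -> 0 <= levy_pdf b w.
Proof.
move=> b0 w0; rewrite /levy_pdf !mulr_ge0 ?expR_ge0 ?invr_ge0 ?ltW//.
by apply: ln_gt0; rewrite ltrDl invr_gt0 mulr_gt0.
Qed.

Lemma levy_pdf_ge0_itv b : 0 < b ->
  forall w, (`]0, +oo[%classic : set R) w -> 0 <= levy_pdf b w.
Proof.
by move=> b0 w /=; rewrite in_itv/= andbT => w0; exact: levy_pdf_ge0.
Qed.

Lemma measurable_levy_pdf (b : R) :
  measurable_fun (`]0, +oo[%classic : set R) (levy_pdf b).
Proof.
apply: measurable_funM; last first.
  apply: measurable_funTS; apply: measurableT_comp => //.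
  by apply: measurableT_comp => //; exact: measurable_funM.
apply: measurable_funM => //.
apply: (eq_measurable_fun (fun w => w `^ (-1))).
  by move=> w; rewrite inE/= in_itv/= andbT => w0; rewrite powR_inv1// ltW.
by apply: measurable_funTS; exact: measurable_powR.
Qed.

Lemma restrict_pdf_ge0 (D : set R) (p : R -> R) :
  (forall x, D x -> 0 <= p x) -> forall x, (0 <= ((EFin \o p) \_ D) x)%E.
Proof.
by move=> p0 x; rewrite patchE; case: ifPn => // /set_mem Dx; rewrite lee_fin p0.
Qed.

Lemma restrict_pdf_lty (D : set R) (p : R -> R) x :
  (((EFin \o p) \_ D) x < +oo)%E.
Proof. by rewrite patchE; case: ifP => // _; rewrite ltry. Qed.

Lemma measurable_restrict_pdf (D : set R) (p : R -> R) : measurable D ->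
  measurable_fun D p -> measurable_fun setT ((EFin \o p) \_ D).
Proof.
by move=> mD /measurable_EFinP mp; exact: (measurable_restrictT _ mD).1 mp.
Qed.

Definition inv_loggamma_ac (a b sigma : R) : set (measurableTypeR R) -> \bar R :=
  density_measure
    (restrict_pdf_ge0 (D := `]0, 1[)
      (fun r _ => inv_loggamma_pdf_ge0 a b sigma r))
    (measurable_restrict_pdf (measurable_itv `]0, 1[)
      (measurable_funTS (measurable_inv_loggamma_pdf a b sigma))).

HB.instance Definition _ a b sigma := Measure.on (inv_loggamma_ac a b sigma).

Let inv_loggamma_ac_sigma_finite a b sigma :
  sigma_finite setT (inv_loggamma_ac a b sigma).
Proof. by apply: density_measure_sigma_finite; exact: restrict_pdf_lty. Qed.

HB.instance Definition _ a b sigma := Measure_isSigmaFinite.Build _ _ _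
  (inv_loggamma_ac a b sigma) (inv_loggamma_ac_sigma_finite a b sigma).

(* For [1 < sigma], the law of [expR (- U)] with [U] of gamma distribution with
   shape [a * ln sigma] and rate [b]. Values [sigma < 1] are not meaningful. *)
Definition inv_loggamma (a b sigma : R) :
    {sigma_finite_measure set (measurableTypeR R) -> \bar R} :=
  if sigma == 1 then [the {sigma_finite_measure set _ -> \bar R} of
                      dirac (1 : measurableTypeR R)]
  else [the {sigma_finite_measure set _ -> \bar R} of
        inv_loggamma_ac a b sigma].

Definition levy_measure (b : R) (b0 : 0 < b) :
    set (measurableTypeR R) -> \bar R :=
  density_measure
    (restrict_pdf_ge0 (D := `]0, +oo[) (levy_pdf_ge0_itv b0))
    (measurable_restrict_pdf (measurable_itv `]0, +oo[)
      (measurable_levy_pdf b)).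

HB.instance Definition _ b (b0 : 0 < b) := Measure.on (levy_measure b0).

Let levy_measure_sigma_finite b (b0 : 0 < b) :
  sigma_finite setT (levy_measure b0).
Proof. by apply: density_measure_sigma_finite; exact: restrict_pdf_lty. Qed.

HB.instance Definition _ b (b0 : 0 < b) := Measure_isSigmaFinite.Build _ _ _
  (levy_measure b0) (levy_measure_sigma_finite b0).

End loggamma.

Section markov.
Context {R : realType}.
Variable G : R -> {sigma_finite_measure set (measurableTypeR R) -> \bar R}.

Definition transition_density (s t x y : R) : \bar R :=
  (\int[G (Num.sqrt (t / s))]_(r in `[0%R, 1%R[)
    (gauss_density (Num.sqrt (t / s) * Num.sqrt r * x) (t * (1 - r)) y)%:E)%E.

Lemma transition_density_ge0 s t x y : (0 <= transition_density s t x y)%E.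
Proof.
by apply: integral_ge0 => r _; rewrite lee_fin /gauss_density normal_pdf_ge0.
Qed.

Lemma measurable_transition_density s t x :
  measurable_fun setT (transition_density s t x).
Proof.
pose sg := Num.sqrt (t / s).
pose h (z : measurableTypeR R * measurableTypeR R) : \bar R :=
  (gauss_density (sg * Num.sqrt z.2 * x) (t * (1 - z.2)) z.1)%:E.
pose D : set (measurableTypeR R * measurableTypeR R) :=
  setT `*` `[0%R, 1%R[%classic.
have mh : measurable_fun setT (h \_ D).
  have mD : measurable D by exact: measurableX.
  apply: (measurable_restrictT h mD).1; apply: measurable_funTS.
  apply/measurable_EFinP; apply: measurable_gauss_density => //.
    apply: measurable_funM => //; apply: measurable_funM => //.
    apply: measurableT_comp => //.
    by apply: continuous_measurable_fun; exact: sqrt_continuous.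
  apply: measurable_funM => //; exact: measurable_funB.
have h0 z : (0 <= (h \_ D) z)%E.
  by rewrite patchE; case: ifP => // _; rewrite lee_fin normal_pdf_ge0.
rewrite (_ : transition_density s t x =
    fubini_F (G sg) (h \_ D)).
  exact: measurable_fun_fubini_tonelli_F.
apply/funext => y; rewrite /transition_density integral_mkcond.
by apply: eq_integral => r _; rewrite !patchE /D in_setX in_setT.
Qed.

(* Meaningful for [0 <= s < t]. When [G sigma] charges the point 1 the
   absolutely continuous part below is not the whole transition probability,
   but [inv_loggamma a b sigma] does not charge 1 for [sigma != 1]. *)
Definition transition (s t x : R) :
    {measure set (measurableTypeR R) -> \bar R} :=
  if s == 0 then [the {measure set _ -> \bar R} of normal_prob x (Num.sqrt t)]
  else [the {measure set _ -> \bar R} of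
        density_measure (transition_density_ge0 s t x)
          (measurable_transition_density s t x)].

End markov.

Section generator.
Context {R : realType}.
Variable P : R -> R -> R -> {measure set (measurableTypeR R) -> \bar R}.

(* [P s t x] is the conditional law at time [t] given the value [x] at time
   [s]. *)
Definition generator_quotient (s : R) (f : R -> R) (x t : R) : R :=
  (t - s)^-1 * ((\int[P s t x]_y f y) - f x).

(* [lim] is a default value when the quotient does not converge, so statements
   on [generator] must come with the convergence. *)
Definition generator (s : R) (f : R -> R) (x : R) : R :=
  lim (generator_quotient s f x t @[t --> s^'+]).

End generator.

(* Main.v *)
(** With [r = e^(-u)] and [sg = sqrt (t / s)], the transition law averages the
    Gaussian mean [F (sg, u) = E (f (sg e^(-u/2) x + sg sqrt (s (1 - e^(-u))) Z))],
    [Z] standard normal, over a gamma law of shape [h = a ln sg] and rate [b] in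
    [u].  Since [F (sg, 0) = f (sg x)], the difference quotient splits into the
    drift [(f (sg x) - f x) / (t - s)] and a multiple of
    [int (F (sg, u) - f (sg x)) u^(h-1) e^(-bu) du].  As [t] decreases to [s],
    [h / (t - s)] tends to [a / (2s)] and [h Gamma(h)] to [1]; because [f] is
    Lipschitz the jump integrand is [O (sqrt u) u^(h-1) e^(-bu)], so dominated
    convergence gives [int (F (1, u) - f x) a u^(-1) e^(-bu) du].  The same
    [O (sqrt u)] bound lets Fubini's theorem exchange the integrals in the
    claimed expression, which turns it into this limit. *)
Require Import Defs.
From mathcomp Require Import all_boot all_order all_algebra.
From mathcomp Require Import all_classical all_reals all_analysis.
From mathcomp Require Import measurable_realfun.
From mathcomp Require Import ring lra.
Import Order.TTheory GRing.Theory Num.Theory.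
Import numFieldNormedType.Exports.
Local Open Scope classical_set_scope.
Local Open Scope ring_scope.
Set Implicit Arguments.
Unset Strict Implicit.
Unset Printing Implicit Defensive.

(** * Integration against a density *)

Import HBNNSimple.

(** The centring at [f (sg x)] instead of [f x] decides the shape of the argument. The weight
    u^(h-1) on the half-line degenerates to u^(-1), which is not integrable at 0. A defect of order
    t - s at u = 0 would meet a mass of order 1/h and survive in the limit; taken out beforehand, it
    is exactly the drift, and what remains vanishes at u = 0 for every t. The rate sqrt u is that of
    the standard deviation sqrt (s (1 - e^(-u))); it leaves u^(-1/2), which is integrable. The
    changes of variables are proved for nonnegative integrands, so a bounded [f] is raised to
    [f + M] first. The final formula lives in the extended reals because the Lévy integral of the
    Gaussian density is infinite at y = 0, where the factor f (x + y) - f x vanishes. *)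

(** Simple functions increase to [f], and monotone convergence passes to the limit on both sides.
    [k] is extended-valued because [transition_density] is. *)
Lemma ge0_integral_density d (T : measurableType d) (R : realType)
    (mu nu : {measure set T -> \bar R}) (k : T -> \bar R) (D : set T)
    (f : T -> \bar R) :
  (forall x, 0 <= k x)%E -> measurable_fun setT k ->
  (forall A, measurable A -> nu A = \int[mu]_(x in A) k x)%E ->
  measurable D -> measurable_fun D f -> (forall x, D x -> 0 <= f x)%E ->
  (\int[nu]_(x in D) f x = \int[mu]_(x in D) (f x * k x))%E.
Proof.
move=> k0 mk nuE mD mf f0.
pose h := nnsfun_approx mD mf.
have hf x : D x -> (h n x)%:E @[n --> \oo] --> f x.
  by move=> Dx; exact: cvg_nnsfun_approx.
have hnd x : {homo (fun n => (h n x)%:E) : n m / (n <= m)%N >-> (n <= m)%E}.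
  by move=> m n mn; rewrite lee_fin; exact/lefP/nd_nnsfun_approx.
(* [k] may take the value [+oo]; then [f x = 0] has to be treated apart. *)
have hkf x : D x -> ((h n x)%:E * k x)%E @[n --> \oo] --> (f x * k x)%E.
  move=> Dx; have := k0 x; case kx: (k x) => [r| |]// _.
    by apply: cvgeZr => //; exact: hf.
  have fsup : f x = ereal_sup (range (fun n => (h n x)%:E)).
    have hs := ereal_nondecreasing_cvgn (hnd x).
    by rewrite -(cvg_lim _ hs)// -(cvg_lim _ (hf _ Dx)).
  have [fx0|fx0] := eqVneq (f x) 0%E.
    have hx0 n : h n x = 0.
      apply/eqP; rewrite eq_le; apply/andP; split; last exact: fun_ge0.
      rewrite -lee_fin (_ : 0%:E = f x)// fsup.
      by apply: ereal_sup_ubound; exists n.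
    rewrite fx0 mul0e; under eq_fun do rewrite hx0 mul0e.
    exact: cvg_cst.
  have {}fx0 : (0 < f x)%E by rewrite lt0e fx0 f0.
  (* Where [f x] is positive the approximants are eventually positive, so their products with [+oo]
     are eventually [+oo]. *)
  rewrite gt0_muley//; apply: cvg_near_cst.
  move: (fx0); rewrite fsup => /ereal_sup_gt[_ [n _ <-] hn].
  exists n => //= m nm; rewrite gt0_muley//.
  exact: (lt_le_trans hn (hnd _ _ _ nm)).
transitivity (limn (fun n => \int[nu]_(x in D) (h n x)%:E)%E).
  rewrite -monotone_convergence//.
  - by apply: eq_integral => x /[!inE] Dx; apply/esym/cvg_lim => //; exact: hf.
  - by move=> n; exact/measurable_EFinP/measurable_funTS.
  - by move=> n x _; rewrite lee_fin.
transitivity (limn (fun n => \int[mu]_(x in D) ((h n x)%:E * k x))%E); last first.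
  rewrite -monotone_convergence//.
  - by apply: eq_integral => x /[!inE] Dx; apply/cvg_lim => //; exact: hkf.
  - move=> n; apply: emeasurable_funM; last exact: measurable_funTS.
    exact/measurable_EFinP/measurable_funTS.
  - by move=> n x _; rewrite mule_ge0// lee_fin.
  - by move=> x Dx m n mn; rewrite lee_wpmul2r//; exact: hnd.
congr (limn _); apply/funext => n.
have mhr r : measurable (h n @^-1` [set r]) by [].
transitivity (\sum_(r \in range (h n))
    (\int[nu]_(x in D) (r * \1_(h n @^-1` [set r]) x)%:E))%E.
  under eq_integral do rewrite fimfunE -fsumEFin//.
  rewrite ge0_integral_fsum//.
  - by move=> r; exact/measurable_EFinP/measurable_funM.
  - by move=> r x _; exact: nnfun_muleindic_ge0.
transitivity (\sum_(r \in range (h n))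
    (\int[mu]_(x in D) ((r * \1_(h n @^-1` [set r]) x)%:E * k x)))%E; last first.
  rewrite -ge0_integral_fsum//.
  - apply: eq_integral => x _.
    rewrite -ge0_mule_fsuml => [|r]; last exact: nnfun_muleindic_ge0.
    by rewrite fsumEFin// -fimfunE.
  - move=> r; apply: emeasurable_funM; last exact: measurable_funTS.
    exact/measurable_EFinP/measurable_funM.
  - by move=> r x _; rewrite mule_ge0// nnfun_muleindic_ge0.
apply: eq_fsbigr => r /[!inE] -[z _ hz].
have r0 : 0 <= r by rewrite -hz.
under eq_integral do rewrite EFinM.
under [RHS]eq_integral do rewrite EFinM -muleA.
rewrite !ge0_integralZl//.
- rewrite integral_indic// nuE; last exact: measurableI.
  rewrite setIC integral_mkcondr; congr (_ * _)%E; apply: eq_integral => x _.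
  by rewrite epatch_indic muleC.
- apply: emeasurable_funM; last exact: measurable_funTS.
  exact/measurable_EFinP.
- by move=> x _; rewrite mule_ge0// lee_fin.
- exact/measurable_EFinP.
Qed.

(** * Changes of variables *)

(** Lebesgue measure and [tau] times its image under the affine map agree on half-open intervals,
    hence on all Borel sets. *)
Lemma ge0_integral_affine (R : realType) (m tau : R) (f : R -> \bar R) :
  0 < tau -> measurable_fun setT f -> (forall y, 0 <= f y)%E ->
  (\int[lebesgue_measure]_y f y =
   tau%:E * \int[lebesgue_measure]_z f (m + tau * z)%R)%E.
Proof.
move=> tau0 mf f0.
pose phi (z : measurableTypeR R) : measurableTypeR R := m + tau * z.
have mphi : measurable_fun setT phi.
  by apply: measurable_funD => //; exact: measurable_funM.
have t0 : 0 <= tau := ltW tau0.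
pose push : {measure set (measurableTypeR R) -> \bar R} :=
  pushforward (@lebesgue_measure R) phi.
pose nu : {measure set (measurableTypeR R) -> \bar R} :=
  mscale (NngNum t0) (push mphi).
have nuE (A : set (measurableTypeR R)) : measurable A -> lebesgue_measure A = nu A.
  apply: lebesgue_measure_unique => _ [[a b] _ <-] /=.
  rewrite /mscale/= /pushforward.
  have -> : phi @^-1` `]a, b] = `](a - m) / tau, (b - m) / tau]%classic.
    apply/seteqP; split => z /=; rewrite !in_itv/= /phi ltr_pdivrMr//
      ler_pdivlMr// ltrBlDl lerBrDl mulrC//.
  rewrite !lebesgue_measure_itv/= !lte_fin ltr_pM2r ?invr_gt0// ltrD2r.
  case: ifP => _; last by rewrite mule0.
  by rewrite -!EFinB -EFinM; congr EFin; field; rewrite gt_eqF.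
transitivity (\int[nu]_y f y)%E.
  by apply: eq_measure_integral => A mA _; exact: nuE.
rewrite /nu ge0_integral_mscale//; congr (_ * _)%E.
by rewrite (ge0_integral_pushforward mphi).
Qed.


Lemma integral_expR_itv (R : realType) (rate c : R) : 0 < rate ->
  (\int[lebesgue_measure]_(u in `]c, +oo[) (expR (- (rate * u)))%:E =
   (expR (- (rate * c)) / rate)%:E)%E.
Proof.
move=> rate0.
pose F (x : R) := - rate^-1 * expR (- rate * x).
have dF (x : R) : is_derive x 1 F (expR (- (rate * x))).
  have h : is_derive x 1 (fun z : R => - rate * z) (- rate).
    have := is_deriveM (is_derive_cst (- rate) x 1) (is_derive_id x 1).
    by rewrite scaler0 addr0 /GRing.scale/= mulr1; exact.
  have := is_deriveM (is_derive_cst (- rate^-1) x 1)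
    (is_derive1_comp (is_derive_expR _) h).
  rewrite scaler0 addr0 /GRing.scale/=.
  rewrite (_ : - rate^-1 * _ = expR (- (rate * x))); first exact.
  by rewrite mulrCA mulrNN mulVf ?gt_eqF// mulr1 mulNr.
have dF1 x : derivable F x 1 by have [] := dF x.
have cF x : {for x, continuous F}.
  by apply: differentiable_continuous; apply/derivable1_diffP.
rewrite integral_itv_obnd_cbnd; last first.
  apply: measurable_funTS; apply/measurable_EFinP; apply: measurableT_comp => //.
  by apply: measurableT_comp => //; exact: measurable_funM.
rewrite (@ge0_continuous_FTC2y _ _ F _ 0).
- by rewrite /F -EFinB sub0r mulNr opprK mulrC mulNr.
- by move=> x _; exact: expR_ge0.
- apply: continuous_subspaceT => x.
  apply: continuous_comp; last exact: continuous_expR.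
  apply: (@cvgN _ R^o); apply: cvgM; [exact: cvg_cst|exact: cvg_id].
- rewrite -(mulr0 (- rate^-1)); apply: cvgM; first exact: cvg_cst.
  rewrite /F; under eq_fun do rewrite mulNr.
  apply: (cvg_comp _ _ _ (@cvgr_expR R)).
  by apply: gt0_cvgMry => //; exact: cvg_id.
- by move=> x _.
- exact: cvg_at_right_filter (cF c).
- by move=> x _; rewrite derive1E; have [_ ->] := dF x.
Qed.

Lemma exponential_prob_itv (R : realType) (c : R) : 0 <= c ->
  exponential_prob 1 `]c, +oo[%classic = (expR (- c))%:E.
Proof.
move=> c0; have := @integral_expR_itv R 1 c ltr01.
rewrite divr1 mul1r => <-; apply: eq_integral => u.
rewrite inE/= in_itv/= andbT => cu.
by rewrite exponential_pdfE ?mul1r ?mulN1r// ltW// (le_lt_trans c0).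
Qed.

(** Inverse transform sampling: [expR (- U)] is uniform on the unit interval when U is exponential
    of rate 1. Finite measures that agree on the rays []-oo, x[] are equal. *)
Lemma pushforward_exponential_prob (R : realType) (A : set (measurableTypeR R)) :
  measurable A ->
  lebesgue_measure (A `&` `]0, 1[) =
  pushforward (exponential_prob 1) (fun u : R => expR (- u)) A.
Proof.
pose phi (u : measurableTypeR R) : measurableTypeR R := expR (- u).
have mphi : measurable_fun setT phi by apply: measurableT_comp.
pose m1 : {measure set (measurableTypeR R) -> \bar R} :=
  mrestr (@lebesgue_measure R) (measurable_itv `]0%R, 1%R[).
pose push : {measure set (measurableTypeR R) -> \bar R} :=
  pushforward (@exponential_prob R 1) phi.
pose m2 := push ltr01 mphi.
pose expo : probability (measurableTypeR R) R := exponential_prob 1.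
pose P := expo ltr01.
have m2le1 B : measurable B -> (m2 B <= 1)%E.
  move=> mB; apply: (@probability_le1 _ _ _ P).
  by rewrite -(setTI (_ @^-1` _)); exact: (mphi measurableT).
have E (x : R) : m1 `]-oo, x[%classic = m2 `]-oo, x[%classic.
  rewrite /m1 /m2 /= /mrestr /pushforward.
  have [x0|x0] := leP x 0.
    rewrite (_ : _ `&` _ = set0); last first.
      rewrite -subset0 => z /= []; rewrite !in_itv/= => zx /andP[z0 _].
      by move: (lt_trans z0 zx); rewrite ltNge x0.
    rewrite (_ : _ @^-1` _ = set0) ?(measure0 P)//.
    rewrite -subset0 => z /=; rewrite in_itv/= => zx.
    by move: (lt_le_trans zx x0); rewrite ltNge expR_ge0.
  have -> : phi @^-1` `]-oo, x[ = `](- ln x), +oo[%classic.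
    apply/seteqP; split => z /=; rewrite !in_itv/= ?andbT /phi => h.
      by rewrite ltrNl -ltr_expR lnK.
    by move: h; rewrite ltrNl -ltr_expR lnK.
  have [x1|x1] := leP x 1.
    rewrite (_ : _ `&` _ = `]0, x[%classic); last first.
      apply/seteqP; split => z /=; rewrite !in_itv/=.
        by move=> [-> /andP[-> _]].
      by move=> /andP[-> zx]; rewrite zx (lt_le_trans zx).
    rewrite lebesgue_measure_itv/= lte_fin x0 oppr0 adde0 exponential_prob_itv.
      by rewrite opprK lnK.
    by rewrite oppr_ge0 ln_le0.
  rewrite (_ : _ `&` _ = `]0, 1[%classic); last first.
    apply/seteqP; split => z /=; rewrite !in_itv/=; first by case.
    by move=> /andP[-> z1]; rewrite z1 (lt_trans z1).
  rewrite lebesgue_measure_itv/= lte_fin ltr01 oppr0 adde0.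
  apply/esym/eqP; rewrite eq_le (@probability_le1 _ _ _ P)//=.
  rewrite -[leLHS](_ : exponential_prob 1 `]0, +oo[%classic = 1%E); last first.
    by rewrite exponential_prob_itv// oppr0 expR0.
  apply: (le_measure P); rewrite ?inE//.
  move=> z /=; rewrite !in_itv/= !andbT; apply: lt_trans.
  by rewrite oppr_lt0 ln_gt0.
move=> mA; change (m1 A = m2 A).
refine (@measure_unique _ R (measurableTypeR R) (@RGenInftyO.G R)
  (fun n => `]-oo, n%:R[%classic) _ _ _ _ m1 m2 _ _ A mA) => //.
- exact: RGenInftyO.measurableE.
- move=> _ _ [x ->] [y ->]; exists (Num.min x y).
  by apply/seteqP; split => z /=; rewrite !in_itv/= lt_min => /andP.
- by move=> n; exists n%:R.
- apply/seteqP; split => // z _; exists (Num.truncn z).+1 => //=.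
  by rewrite in_itv/= truncnS_gt.
- by move=> _ [x ->]; exact: E.
- by move=> n; rewrite E; apply: le_lt_trans (ltry 1); exact: m2le1.
Qed.

(** The substitution r = e^(-u) is read as an image of the exponential law, whose density supplies
    the Jacobian; this way [f] only has to be measurable. *)
Lemma ge0_integral_expRN (R : realType) (f : R -> \bar R) :
  measurable_fun setT f -> (forall y, 0 <= f y)%E ->
  (\int[lebesgue_measure]_(r in `]0%R, 1%R[) f r =
   \int[lebesgue_measure]_(u in `]0%R, +oo[)
      (f (expR (- u)) * (expR (- u))%:E))%E.
Proof.
move=> mf f0.
pose phi (u : measurableTypeR R) : measurableTypeR R := expR (- u).
have mphi : measurable_fun setT phi by apply: measurableT_comp.
pose push : {measure set (measurableTypeR R) -> \bar R} :=
  pushforward (@exponential_prob R 1) phi.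
pose m2 := push ltr01 mphi.
transitivity (\int[m2]_(r in `]0%R, 1%R[) f r)%E.
  apply: eq_measure_integral => A mA A01.
  by rewrite -{1}(setIidl A01); exact: pushforward_exponential_prob.
rewrite (ge0_integral_pushforward mphi)//; last exact: measurable_funTS.
rewrite (_ : _ @^-1` _ = `]0, +oo[%classic); last first.
  apply/seteqP; split => u /=; rewrite !in_itv/= /phi expR_lt1 oppr_lt0 andbT.
    by case/andP.
  by move=> ->; rewrite expR_gt0.
rewrite (@ge0_integral_density _ _ _ lebesgue_measure _
  (EFin \o exponential_pdf 1))//=.
- apply: eq_integral => u; rewrite inE/= in_itv/= andbT => u0.
  by rewrite exponential_pdfE ?ltW// mul1r mulN1r.
- by move=> x; rewrite lee_fin exponential_pdf_ge0.
- by apply/measurable_EFinP; exact: measurable_exponential_pdf.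
- apply: measurable_funTS; exact: measurableT_comp.
Qed.

(** * The Gamma function *)

Lemma integral_powR_itv01 (R : realType) (p : R) : 0 < p ->
  (\int[lebesgue_measure]_(r in `]0%R, 1%R[) (r `^ (p - 1))%:E = p^-1%:E)%E.
Proof.
move=> p0; rewrite (ge0_integral_expRN (f := fun r => (r `^ (p - 1))%:E)).
- have := @integral_expR_itv R p 0 p0.
  rewrite mulr0 oppr0 expR0 div1r => <-.
  apply: eq_integral => u _; rewrite -EFinM -expRM -expRD.
  by congr (expR _)%:E; ring.
- by apply/measurable_EFinP; exact: measurable_powR.
- by move=> y; rewrite lee_fin powR_ge0.
Qed.

Lemma measurable_gamma_integrand (R : realType) (p c : R) (D : set R) :
  measurable_fun D (fun u : R => u `^ (p - 1) * expR (- (c * u))).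
Proof.
apply: measurable_funTS; apply: measurable_funM; first exact: measurable_powR.
by apply: measurableT_comp => //; apply: measurableT_comp => //; exact: measurable_funM.
Qed.

(** The two pieces of the Gamma integral are of different nature: u^(p-1) governs the head, the
    exponential governs the tail. *)
Lemma ge0_integral_itv0y_split (R : realType) (f : R -> \bar R) :
  measurable_fun setT f -> (forall u, 0 <= f u)%E ->
  (\int[lebesgue_measure]_(u in `]0%R, +oo[) f u =
   \int[lebesgue_measure]_(u in `]0%R, 1%R[) f u +
   \int[lebesgue_measure]_(u in `]1%R, +oo[) f u)%E.
Proof.
move=> mf f0.
rewrite [X in _ = (_ + X)%E]integral_itv_obnd_cbnd; last exact: measurable_funTS.
rewrite -ge0_integral_setU//=; last 2 first.
- exact: measurable_funTS.
- apply/disj_setPRL => x /=; rewrite !in_itv/= andbT.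
  by move=> x1 /andP[_]; rewrite ltNge x1.
congr integral; apply/seteqP; split => x /=; rewrite !in_itv/= !andbT.
  by move=> x0; rewrite x0/=; have [|] := ltP x 1; [left|right].
by move=> [/andP[]//|]; exact: lt_le_trans.
Qed.

Section gamma_bounds.
Context {R : realType}.
Local Notation mu := (@lebesgue_measure R).
Local Notation g p := (fun u : R => (u `^ (p - 1) * expR (- u))%:E).

Let mg p : measurable_fun setT (g p).
Proof.
apply/measurable_EFinP.
under eq_fun => u do rewrite -[X in expR (- X)]mul1r.
exact: measurable_gamma_integrand.
Qed.

Let mgS p (D : set R) : measurable_fun D (g p).
Proof. by apply: measurable_funTS; exact: mg. Qed.

Let g_ge0 p u : (0 <= g p u)%E.
Proof. by rewrite lee_fin mulr_ge0 ?powR_ge0 ?expR_ge0. Qed.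

Let mpow p (D : set R) : measurable_fun D (fun u : R => (u `^ p)%:E).
Proof. by apply: measurable_funTS; apply/measurable_EFinP; exact: measurable_powR. Qed.

Let gamma_head_le p : 0 < p -> (\int[mu]_(u in `]0%R, 1%R[) g p u <= p^-1%:E)%E.
Proof.
move=> p0; rewrite -integral_powR_itv01//; apply: ge0_le_integral => //.
- exact: mgS.
- exact: mpow.
- move=> u; rewrite /= in_itv/= => /andP[u0 _]; rewrite lee_fin.
  by rewrite ler_piMr ?powR_ge0// expR_le1 oppr_le0 ltW.
Qed.

(** Integrates u^(p-1) (1 - u) <= u^(p-1) e^(-u), with the subtracted term moved to the right so
    that only nonnegative integrals occur. *)
Let gamma_head_ge p : 0 < p ->
  (p^-1%:E <= \int[mu]_(u in `]0%R, 1%R[) g p u + (p + 1)^-1%:E)%E.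
Proof.
move=> p0; rewrite -integral_powR_itv01// -integral_powR_itv01 ?addr_gt0//.
rewrite -ge0_integralD//; last 3 first.
- exact: mgS.
- by move=> u _; rewrite lee_fin powR_ge0.
- exact: mpow.
apply: ge0_le_integral => //.
- by move=> u _; rewrite lee_fin powR_ge0.
- exact: mpow.
- by apply: emeasurable_funD; [exact: mgS|exact: mpow].
- move=> u; rewrite /= in_itv/= => /andP[u0 _]; rewrite -EFinD lee_fin.
  rewrite (_ : p + 1 - 1 = (p - 1) + 1); last by ring.
  rewrite [u `^ (_ + 1)]powRD; last by apply/implyP => _; rewrite gt_eqF.
  rewrite powRr1; last exact: ltW.
  rewrite -mulrDr ler_peMr ?powR_ge0//.
  by have := expR_ge1Dx (- u); lra.
Qed.

Let gamma_tail_le1 p : p <= 1 -> (\int[mu]_(u in `]1%R, +oo[) g p u <= 1)%E.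
Proof.
move=> p1; apply: (@le_trans _ _ (\int[mu]_(u in `]1%R, +oo[) (expR (- (1 * u)))%:E)%E).
  apply: ge0_le_integral => //.
  - exact: mgS.
  - apply: measurable_funTS; apply/measurable_EFinP; apply: measurableT_comp => //.
    by apply: measurableT_comp => //; exact: measurable_funM.
  - move=> u; rewrite /= in_itv/= andbT => u1; rewrite lee_fin mul1r.
    rewrite ler_piMl ?expR_ge0// -[leRHS](powRr0 u).
    by apply: ler_powR; [exact: ltW|rewrite subr_le0].
by rewrite integral_expR_itv// divr1 lee_fin expR_le1 mul1r oppr_le0.
Qed.

Let gamma_tail_lty p : (\int[mu]_(u in `]1%R, +oo[) g p u < +oo)%E.
Proof.
pose n := Num.truncn `|p|.
have pn : p - 1 <= n.+1%:R.
  by have := truncnS_gt `|p|; have := ler_norm p; rewrite /n; lra.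
(* From y^(n+1) / (n+1)! <= e^y at y = u / 2: one half of the exponential absorbs the power, the
   other half is integrated. *)
pose K : R := n.+1`!%:R * 2 ^+ n.+1.
have K0 : 0 <= K by rewrite mulr_ge0 ?ler0n ?exprn_ge0.
apply: (@le_lt_trans _ _
  (\int[mu]_(u in `]1%R, +oo[) (K%:E * (expR (- (2^-1 * u)))%:E))%E).
  apply: ge0_le_integral => //.
  - exact: mgS.
  - apply: measurable_funTS; apply: measurable_funeM.
    apply/measurable_EFinP; apply: measurableT_comp => //.
    by apply: measurableT_comp => //; exact: measurable_funM.
  - move=> u; rewrite /= in_itv/= andbT => u1; rewrite -EFinM lee_fin.
    have u0 : 0 <= u by rewrite ltW// (lt_trans ltr01).
    have -> : expR (- u) = expR (- (2^-1 * u)) * expR (- (2^-1 * u)).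
      by rewrite -expRD; congr expR; field.
    rewrite mulrA ler_wpM2r ?expR_ge0//.
    apply: (@le_trans _ _ (u ^+ n.+1 * expR (- (2^-1 * u)))).
      rewrite ler_wpM2r ?expR_ge0// -powR_mulrn//.
      by apply: ler_powR => //; exact: ltW.
    rewrite expRN ler_pdivrMr ?expR_gt0//.
    have := @expR_ge1Dxn R (2^-1 * u) n; rewrite mulr_ge0// => /(_ isT) h.
    have {}h : (2^-1 * u) ^+ n.+1 / n.+1`!%:R <= expR (2^-1 * u).
      by apply: le_trans h; rewrite lerDr.
    apply: (@le_trans _ _ (K * ((2^-1 * u) ^+ n.+1 / n.+1`!%:R))).
      rewrite le_eqVlt; apply/orP; left; apply/eqP.
      rewrite exprMn /K exprVn; field; rewrite expf_neq0//= pnatr_eq0 -lt0n.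
      by rewrite fact_gt0.
    by rewrite ler_wpM2l.
rewrite ge0_integralZl//.
- by rewrite integral_expR_itv// -EFinM ltry.
- apply: measurable_funTS; apply/measurable_EFinP; apply: measurableT_comp => //.
  by apply: measurableT_comp => //; exact: measurable_funM.
Qed.

(** [Gamma] is the finite part of an extended integral, so it has its intended value only once that
    integral is known to be finite. *)
Lemma Gamma_EFin (p : R) : 0 < p ->
  (Gamma p)%:E = (\int[mu]_(u in `]0%R, +oo[) (u `^ (p - 1) * expR (- u))%:E)%E.
Proof.
move=> p0; rewrite fineK// ge0_fin_numE; last exact: integral_ge0.
rewrite ge0_integral_itv0y_split// lte_add_pinfty//.
exact: le_lt_trans (gamma_head_le p0) (ltry p^-1).
Qed.

Lemma Gamma_ge (p : R) : 0 < p -> (p^-1 <= Gamma p + (p + 1)^-1).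
Proof.
move=> p0; rewrite -lee_fin EFinD Gamma_EFin//.
apply: le_trans (gamma_head_ge p0) _; rewrite leeD2r// ge0_integral_itv0y_split//.
by rewrite leeDl// integral_ge0.
Qed.

Lemma Gamma_gt0 (p : R) : 0 < p -> 0 < Gamma p.
Proof.
move=> p0; have := Gamma_ge p0; rewrite -lerBlDr; apply: lt_le_trans.
by rewrite subr_gt0 ltf_pV2 ?posrE ?addr_gt0// ltrDl.
Qed.

Lemma Gamma_le (p : R) : 0 < p -> p <= 1 -> Gamma p <= p^-1 + 1.
Proof.
move=> p0 p1; rewrite -lee_fin EFinD Gamma_EFin// ge0_integral_itv0y_split//.
by rewrite leeD ?gamma_head_le ?gamma_tail_le1.
Qed.

(** Multiplied by h, [Gamma_ge] and [Gamma_le] squeeze the product between 1 - h / (h + 1) and 1 +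
    h. *)
Lemma cvg_mulGamma0 : h * Gamma h @[h --> (0 : R)^'+] --> (1 : R).
Proof.
apply: (@squeeze_cvgr _ _ _ _ (fun h => 1 - h) (fun h => 1 + h)).
- near=> h; have h0 : 0 < h by near: h; exact: nbhs_right_gt.
  have h1 : h <= 1 by near: h; exact: nbhs_right_le.
  apply/andP; split.
    have := Gamma_ge h0; rewrite -(ler_pM2l h0) mulfV ?gt_eqF// mulrDr => H.
    rewrite lerBlDr; apply: le_trans H _; rewrite lerD2l ler_piMr//.
    by rewrite invf_le1 ?addr_gt0// lerDr ltW.
  have := Gamma_le h0 h1; rewrite -(ler_pM2l h0) mulrDr mulfV ?gt_eqF// mulr1//.
- rewrite -[X in _ --> X]subr0; apply: cvg_at_right_filter.
  by apply: (@cvgB _ R^o); [exact: cvg_cst|exact: cvg_id].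
- rewrite -[X in _ --> X]addr0; apply: cvg_at_right_filter.
  by apply: (@cvgD _ R^o); [exact: cvg_cst|exact: cvg_id].
Unshelve. all: by end_near. Qed.

Lemma integral_gamma (b p : R) : 0 < b -> 0 < p ->
  (\int[mu]_(u in `]0%R, +oo[) (u `^ (p - 1) * expR (- (b * u)))%:E =
   (b `^ (- p) * Gamma p)%:E)%E.
Proof.
move=> b0 p0.
rewrite EFinM Gamma_EFin// [in RHS]integral_mkcond.
rewrite (@ge0_integral_affine _ 0 b)//; last 2 first.
- by apply: (measurable_restrictT _ _).1 => //; exact: mgS.
- by move=> y; rewrite patchE; case: ifPn => // _; exact: g_ge0.
rewrite [in LHS]integral_mkcond muleA -EFinM.
transitivity ((b `^ (- p) * b)%:E * (\int[mu]_u ((b `^ (p - 1))%:E *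
   ((fun u => (u `^ (p - 1) * expR (- (b * u)))%:E) \_ `]0%R, +oo[) u)))%E.
  rewrite ge0_integralZl//; last 3 first.
  - apply: (measurable_restrictT _ _).1 => //; apply/measurable_EFinP.
    exact: measurable_gamma_integrand.
  - move=> u _; rewrite patchE; case: ifPn => // _.
    by rewrite lee_fin mulr_ge0 ?powR_ge0 ?expR_ge0.
  - by rewrite lee_fin powR_ge0.
  rewrite muleA -EFinM -mulrA -[X in _ * (X * _)](powRr1 (ltW b0)) -!powRD.
  - by rewrite (_ : - p + _ = 0) ?powRr0 ?mul1e//; ring.
  - by apply/implyP => _; rewrite gt_eqF.
  - by apply/implyP => _; rewrite gt_eqF.
congr (_ * _)%E; apply: eq_integral => u _; rewrite !patchE.
rewrite add0r !mem_setE !in_itv/= !andbT pmulr_rgt0//.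
case: ifPn => u0; last by rewrite mule0.
by rewrite -EFinM powRM ?ltW// mulrA.
Qed.

End gamma_bounds.

(** * Gaussian averages of Lipschitz functions *)

Lemma normal_pdf_affine (R : realType) (m tau z : R) : 0 < tau ->
  tau * normal_pdf m tau (m + tau * z) = normal_pdf 0 1 z.
Proof.
move=> tau0; have tauN0 : tau != 0 by rewrite gt_eqF.
rewrite !normal_pdfE ?oner_neq0// mulrA; congr (_ * _).
  rewrite /normal_peak -mulrnAr sqrtrM ?sqr_ge0// sqrtr_sqr gtr0_norm//.
  by rewrite invfM mulrA mulfV// mul1r expr1n mul1r.
rewrite /normal_fun; congr expR.
by rewrite subr0 addrC addKr expr1n exprMn; field.
Qed.

Lemma ge0_integral_normal_prob (R : realType) (m s : R) (f : R -> \bar R) :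
  measurable_fun setT f -> (forall z, 0 <= f z)%E ->
  (\int[normal_prob m s]_z f z =
   \int[lebesgue_measure]_z (f z * (normal_pdf m s z)%:E))%E.
Proof.
move=> mf f0; apply: ge0_integral_density => //.
- by move=> z; rewrite lee_fin normal_pdf_ge0.
- by apply/measurable_EFinP; exact: measurable_normal_pdf.
Qed.

(** Moves mean and variance from the density into the integrand, so that all Gaussian averages are
    taken over one and the same standard normal variable. *)
Lemma ge0_integral_gauss_density (R : realType) (f : R -> R) (m v : R) :
  0 < v -> measurable_fun setT f -> (forall y, 0 <= f y) ->
  (\int[lebesgue_measure]_y (f y * gauss_density m v y)%:E =
   \int[normal_prob 0 1]_z (f (m + Num.sqrt v * z))%:E)%E.
Proof.
move=> v0 mf f0; have tau0 : 0 < Num.sqrt v by rewrite sqrtr_gt0.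
have mpdf (m' s' : R) : measurable_fun setT (fun y => (normal_pdf m' s' y)%:E).
  by apply/measurable_EFinP; exact: measurable_normal_pdf.
have maff : measurable_fun setT (fun z : R => m + Num.sqrt v * z).
  by apply: measurable_funD => //; exact: measurable_funM.
rewrite (@ge0_integral_affine _ m (Num.sqrt v))//; last 2 first.
- apply/measurable_EFinP; apply: measurable_funM => //.
  exact: measurable_normal_pdf.
- by move=> y; rewrite lee_fin mulr_ge0 ?normal_pdf_ge0.
rewrite ge0_integral_normal_prob//; last 2 first.
- by apply/measurable_EFinP; exact: (measurableT_comp mf).
- by move=> z; rewrite lee_fin.
rewrite -ge0_integralZl//; last 2 first.
- apply/measurable_EFinP; apply: measurable_funM; first exact: (measurableT_comp mf).
  exact: (measurableT_comp (measurable_normal_pdf _ _)).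
- by move=> y _; rewrite lee_fin mulr_ge0 ?normal_pdf_ge0.
apply: eq_integral => z _; rewrite -!EFinM mulrCA /gauss_density.
by rewrite normal_pdf_affine.
Qed.

Lemma integrable_normr_normal_prob (R : realType) :
  (normal_prob (0 : R) 1).-integrable setT (fun z => `|z|%:E).
Proof.
have mn : measurable_fun setT (fun z : R => `|z|%:E).
  by apply/measurable_EFinP; exact: normr_measurable.
apply/integrableP; split => //.
under eq_integral do rewrite /= normr_id.
have mpdf (m' s' : R) : measurable_fun setT (fun y => (normal_pdf m' s' y)%:E).
  by apply/measurable_EFinP; exact: measurable_normal_pdf.
rewrite ge0_integral_normal_prob//.
have s2 : Num.sqrt 2 != 0 :> R by rewrite gt_eqF// sqrtr_gt0.
(* The bounding density has variance 2, hence exponential e^(-z^2/4); [K] corrects the normalizing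
   constants. *)
pose K : R := normal_peak 1 / normal_peak (Num.sqrt 2).
have K0 : 0 <= K by rewrite divr_ge0 ?normal_peak_ge0.
(* [|z| exp (- z^2 / 2) <= exp (- z^2 / 4)] *)
apply: (@le_lt_trans _ _ (\int[lebesgue_measure]_z
  (K%:E * (normal_pdf 0 (Num.sqrt 2) z)%:E))%E).
  apply: ge0_le_integral => //.
  - by move=> z _; rewrite lee_fin mulr_ge0 ?normal_pdf_ge0.
  - exact: (emeasurable_funM mn (mpdf _ _)).
  - exact: (measurable_funeM _ (mpdf _ _)).
  move=> z _; rewrite -!EFinM lee_fin !normal_pdfE ?oner_neq0//.
  rewrite /K mulrA -mulrA.
  rewrite -[X in _ <= X]mulrA [X in _ <= _ * X]mulrA mulVf ?mul1r; last first.
    by rewrite gt_eqF// normal_peak_gt0.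
  rewrite mulrCA ler_wpM2l ?normal_peak_ge0// /normal_fun !subr0 expr1n sqr_sqrtr//.
  rewrite (_ : - z ^+ 2 / (1 *+ 2) = - z ^+ 2 / (2 *+ 2) - z ^+ 2 / 4); last by field.
  rewrite expRD mulrCA ler_piMr ?expR_ge0// expRN ler_pdivrMr ?expR_gt0// mul1r.
  apply: le_trans (expR_ge1Dx _).
  rewrite -real_normK ?num_real//.
  (* This square gives |z| <= 1 + z^2 / 4. *)
  have := sqr_ge0 (1 - `|z| / 2); lra.
rewrite ge0_integralZl//.
- by rewrite integral_normal_pdf mule1 ltry.
- exact: mpdf.
by move=> z _; rewrite lee_fin normal_pdf_ge0.
Qed.

(** Written with a standard normal variable rather than [gauss_density], so that [tau = 0] yields
    [f m] and not the conventional value of a degenerate density. *)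
Definition gauss_smooth (R : realType) (f : R -> R) (m tau : R) : R :=
  \int[normal_prob 0 1]_z f (m + tau * z).

Section gauss_smooth.
Context {R : realType} (f : R -> R) (M C : R).
Hypothesis f_bnd : forall y, `|f y| <= M.
Hypothesis f_lip : forall y z, `|f y - f z| <= C * `|y - z|.
Local Notation P := (normal_prob (0 : R) 1).
Local Notation H := (gauss_smooth f).

Lemma lipschitz_measurable : measurable_fun setT f.
Proof.
apply: continuous_measurable_fun => y; apply/cvgrPdist_le => e e0.
have C0 : 0 <= C.
  by have := f_lip 1 0; rewrite subr0 normr1 mulr1; exact: le_trans.
near=> z; apply: le_trans (f_lip _ _) _.
(* [C + 1] because [C] may be zero. *)
have : `|y - z| <= e / (C + 1).
  near: z; apply: cvgr_dist_le; first exact: cvg_id.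
  by rewrite divr_gt0// ltr_wpDl.
rewrite ler_pdivlMr ?ltr_wpDl// mulrC; apply: le_trans.
by rewrite ler_wpM2r// lerDl.
Unshelve. all: by end_near. Qed.

Let C0 : 0 <= C.
Proof. by have := f_lip 1 0; rewrite subr0 normr1 mulr1; exact: le_trans. Qed.

Let maff (m tau : R) : measurable_fun setT (fun z : R => m + tau * z).
Proof. by apply: measurable_funD => //; exact: measurable_funM. Qed.

Lemma integrable_gauss_smooth (m tau : R) :
  P.-integrable setT (fun z => (f (m + tau * z))%:E).
Proof.
apply: (@le_integrable _ _ _ _ _ _ _ (cst M%:E)) => //.
- apply/measurable_EFinP; apply: measurableT_comp (maff _ _).
  exact: lipschitz_measurable.
- move=> z _ /=; rewrite lee_fin; apply: le_trans (f_bnd _) _; exact: ler_norm.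
- by apply/integrableP; split => //=; rewrite integral_cst//= probability_setT mule1 ltry.
Qed.

Lemma gauss_smooth0 (m : R) : H m 0 = f m.
Proof.
rewrite /gauss_smooth; under eq_Rintegral do rewrite mul0r addr0.
by rewrite Rintegral_cst//= probability_setT mulr1.
Qed.

Lemma gauss_smooth_EFin (m tau : R) :
  (\int[P]_z (f (m + tau * z))%:E = (H m tau)%:E)%E.
Proof.
rewrite fineK//; apply: integrable_fin_num => //.
exact: integrable_gauss_smooth.
Qed.

Lemma integrable_gauss_lip (m tau : R) :
  P.-integrable setT (fun z => (C * (`|m| + `|tau| * `|z|))%:E).
Proof.
have -> : (fun z : R => (C * (`|m| + `|tau| * `|z|))%:E) =
    (fun z => (C * `|m|)%:E + (C * `|tau|)%:E * `|z|%:E)%E.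
  by apply/funext => z; rewrite -EFinM -EFinD mulrDr mulrA.
apply: integrableD => //.
  by apply/integrableP; split => //=; rewrite integral_cst//= probability_setT mule1 ltry.
by apply: integrableZl => //; exact: integrable_normr_normal_prob.
Qed.

Lemma gauss_lip_EFin (m tau : R) :
  (\int[P]_z (C * (`|m| + `|tau| * `|z|))%:E =
   (C * (`|m| + `|tau| * \int[P]_z `|z|))%:E)%E.
Proof.
under eq_integral do rewrite mulrDr mulrA EFinD EFinM.
rewrite integralD//=; last 2 first.
- by apply/integrableP; split => //=; rewrite integral_cst//= probability_setT mule1 ltry.
- under eq_fun do rewrite EFinM; apply: integrableZl => //.
  exact: integrable_normr_normal_prob.
under [X in (_ + X)%E]eq_integral do rewrite EFinM.
rewrite integralZl//; last exact: integrable_normr_normal_prob.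
rewrite -EFinM integral_cst//= probability_setT mule1 mulrDr EFinD; congr (_ + _)%E.
rewrite mulrA [in RHS]EFinM fineK//; apply: integrable_fin_num => //.
exact: integrable_normr_normal_prob.
Qed.

(** A coupling: both Gaussian variables are driven by the same standard normal, so they differ by at
    most |m - m'| + |tau - tau'| |z|. *)
Lemma gauss_smooth_lip (m tau m' tau' : R) :
  `|H m tau - H m' tau'| <=
    C * (`|m - m'| + `|tau - tau'| * \int[P]_z `|z|).
Proof.
have iB : P.-integrable setT
    (EFin \o (fun z => f (m + tau * z) - f (m' + tau' * z))).
  exact: (integrableB measurableT (integrable_gauss_smooth m tau)
    (integrable_gauss_smooth m' tau')).
rewrite /gauss_smooth -RintegralB//; [|exact: integrable_gauss_smooth..].
apply: le_trans (le_normr_Rintegral _ iB) _ => //.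
rewrite -lee_fin -gauss_lip_EFin fineK; last first.
  by apply: integrable_fin_num => //; exact: integrable_norm.
apply: ge0_le_integral => //.
- apply/measurable_EFinP; apply: measurableT_comp => //.
  by apply: measurable_funB; apply: measurableT_comp (maff _ _);
    exact: lipschitz_measurable.
- exact: measurable_int (integrable_gauss_lip _ _).
- move=> z _; rewrite lee_fin; apply: le_trans (f_lip _ _) _.
  rewrite ler_wpM2l// -normrM; apply: le_trans (ler_normD _ _).
  by rewrite le_eqVlt; apply/orP; left; apply/eqP; congr `| _ |; ring.
Qed.

Lemma cvg_gauss_smooth (T : Type) (F : set_system T) (FF : Filter F)
    (m tau : T -> R) (m0 tau0 : R) :
  m t @[t --> F] --> m0 -> tau t @[t --> F] --> tau0 ->
  H (m t) (tau t) @[t --> F] --> H m0 tau0.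
Proof.
move=> mm0 tautau0.
set E := \int[P]_z `|z|.
have B0 : C * (`|m t - m0| + `|tau t - tau0| * E) @[t --> F] --> (0 : R).
  rewrite (_ : 0 = C * (`|m0 - m0| + `|tau0 - tau0| * E)); last first.
    by rewrite !subrr normr0 mul0r addr0 mulr0.
  apply: cvgM; first exact: cvg_cst.
  apply: (@cvgD _ R^o).
    by apply: cvg_norm; apply: (@cvgB _ R^o) => //; exact: cvg_cst.
  apply: cvgM; last exact: cvg_cst.
  by apply: cvg_norm; apply: (@cvgB _ R^o) => //; exact: cvg_cst.
apply/cvgrPdist_le => e e0; move/cvgrPdist_le : B0 => /(_ _ e0).
apply: filterS => t; rewrite sub0r normrN => h.
rewrite distrC; apply: le_trans (gauss_smooth_lip _ _ _ _) _.
exact: le_trans (ler_norm _) h.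
Qed.

End gauss_smooth.

(** * The transition law as a gamma mixture *)

Section transition_formula.
Context {R : realType}.
Local Notation mu := (@lebesgue_measure R).

Lemma loggamma_shape_gt0 (b : R) : 0 < b -> 0 < loggamma_shape b.
Proof.
by move=> b0; rewrite invr_gt0 ln_gt0// ltrDl invr_gt0 mulr_gt0.
Qed.

Lemma measurable_gauss_smoothing d (T : measurableType d) (g : R -> R)
    (m tau : T -> R) :
  measurable_fun setT g -> (forall y, 0 <= g y) ->
  measurable_fun setT m -> measurable_fun setT tau ->
  measurable_fun setT
    (fun t => \int[normal_prob 0 1]_z (g (m t + tau t * z))%:E)%E.
Proof.
move=> mg g0 mm mtau.
apply: (@measurable_fun_fubini_tonelli_F _ _ T (measurableTypeR R) R
  (normal_prob 0 1) (fun tz => (g (m tz.1 + tau tz.1 * tz.2))%:E)).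
- apply/measurable_EFinP; apply: (measurableT_comp mg).
  apply: measurable_funD; first exact: measurableT_comp.
  by apply: measurable_funM => //; exact: measurableT_comp.
- by move=> tz; rewrite lee_fin.
Qed.

(** Tonelli integrates [y] first, at fixed [r], which leaves a standard normal average; then r =
    e^(-u) turns the inverse log-gamma law into a gamma law. The factor [sg] comes out of the
    standard deviation because t = sg^2 s. *)
Lemma ge0_integral_transition (a b s t x : R) (g : R -> R) :
  0 < s -> s < t -> measurable_fun setT g -> (forall y, 0 <= g y) ->
  let sg := Num.sqrt (t / s) in
  (\int[transition (inv_loggamma a b) s t x]_y (g y)%:E =
   \int[mu]_(u in `]0%R, +oo[)
     (\int[normal_prob 0 1]_z
        (g (sg * expR (- u / 2) * x + sg * Num.sqrt (s * (1 - expR (- u))) * z))%:E *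
      (b `^ (a * ln sg) / Gamma (a * ln sg) *
        (u `^ (a * ln sg - 1) * expR (- (b * u))))%:E))%E.
Proof.
move=> s0 st mg g0 sg.
have t0 : 0 < t := lt_trans s0 st.
have sg1 : 1 < sg.
  by rewrite /sg -(sqrtr1 R) ltr_sqrt ?divr_gt0// ltr_pdivlMr// mul1r.
pose m (r : measurableTypeR R) := sg * Num.sqrt r * x.
pose v (r : measurableTypeR R) := t * (1 - r).
have mm : measurable_fun setT m.
  apply: measurable_funM => //; apply: measurable_funM => //.
  by apply: continuous_measurable_fun; exact: sqrt_continuous.
have mv : measurable_fun setT v.
  by apply: measurable_funM => //; exact: measurable_funB.
have msv : measurable_fun setT (fun r => Num.sqrt (v r)).
  apply: measurableT_comp mv.
  by apply: continuous_measurable_fun; exact: sqrt_continuous.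
pose K (r : measurableTypeR R) : \bar R :=
  (\int[normal_prob 0 1]_z (g (m r + Num.sqrt (v r) * z))%:E)%E.
have mK : measurable_fun setT K by exact: measurable_gauss_smoothing.
have K0 r : (0 <= K r)%E.
  by apply: integral_ge0 => z _; rewrite lee_fin.
transitivity (\int[inv_loggamma a b sg]_(r in `[0%R, 1%R[) K r)%E.
  rewrite /transition gt_eqF//=.
  rewrite (@ge0_integral_density _ _ _ mu _
    (transition_density (inv_loggamma a b) s t x))//; last 4 first.
  - by move=> y; exact: transition_density_ge0.
  - exact: measurable_transition_density.
  - exact/measurable_EFinP.
  - by move=> y _; rewrite lee_fin.
  pose F (yr : measurableTypeR R * measurableTypeR R) : \bar R :=
    ((fun r => (g yr.1 * gauss_density (m r) (v r) yr.1)%:E) \_ `[0%R, 1%R[) yr.2.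
  have F0 yr : (0 <= F yr)%E.
    rewrite /F patchE; case: ifPn => // _.
    by rewrite lee_fin mulr_ge0// /gauss_density normal_pdf_ge0.
  have mF : measurable_fun setT F.
    pose D : set (measurableTypeR R * measurableTypeR R) :=
      setT `*` `[0%R, 1%R[%classic.
    have mD : measurable D by exact: measurableX.
    have -> : F = (fun yr => (g yr.1 * gauss_density (m yr.2) (v yr.2) yr.1)%:E) \_ D.
      apply/funext => yr; rewrite /F !patchE /D.
      by congr (if _ then _ else _); apply/idP/idP; rewrite !inE/=; [split|case].
    apply: (measurable_restrictT _ mD).1; apply: measurable_funTS.
    apply/measurable_EFinP; apply: measurable_funM; first exact: measurableT_comp.
    by apply: measurable_gauss_density => //; exact: measurableT_comp.
  transitivity (\int[mu]_y \int[inv_loggamma a b sg]_r F (y, r))%E.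
    apply: eq_integral => y _.
    rewrite /transition_density -/sg -ge0_integralZl//; last 3 first.
    - apply/measurable_EFinP; apply: measurable_funTS.
      by apply: measurable_gauss_density => //; exact: measurable_cst.
    - by move=> r _; rewrite lee_fin /gauss_density normal_pdf_ge0.
    - by rewrite lee_fin.
    by rewrite integral_mkcond; apply: eq_integral => r _; rewrite /F !patchE.
  rewrite fubini_tonelli//.
  rewrite [RHS]integral_mkcond; apply: eq_integral => r _.
  rewrite /F patchE; case: ifPn => rD; last first.
    by rewrite integral0_eq// => y _; rewrite patchE (negbTE rD).
  have v0 : 0 < v r.
    by move: rD; rewrite inE/= in_itv/= => /andP[_ r1]; rewrite mulr_gt0// subr_gt0.
  rewrite /K -ge0_integral_gauss_density//; apply: eq_integral => y _.
  by rewrite patchE rD.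
rewrite /inv_loggamma gt_eqF//=.
rewrite (@ge0_integral_density _ _ _ mu _
  ((EFin \o inv_loggamma_pdf a b sg) \_ `]0%R, 1%R[))//; last 3 first.
- apply: restrict_pdf_ge0 => r _; exact: inv_loggamma_pdf_ge0.
- apply: measurable_restrict_pdf => //.
  by apply: measurable_funTS; exact: measurable_inv_loggamma_pdf.
- exact: measurable_funTS.
(* The transition integrates over [[0, 1[], but the restricted density is zero at the extra point
   0. *)
transitivity (\int[mu]_(r in `]0%R, 1%R[) (K r * (inv_loggamma_pdf a b sg r)%:E))%E.
  rewrite [LHS]integral_mkcond [RHS]integral_mkcond; apply: eq_integral => r _.
  rewrite !patchE !mem_setE !in_itv/=.
  have [r0|r0] := ltP 0 r; first by rewrite (ltW r0)/=; case: (r < 1).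
  by case: ifP => // _; exact: mule0.
rewrite (@ge0_integral_expRN _
  (fun r => K r * (inv_loggamma_pdf a b sg r)%:E))%E//; last 2 first.
- apply: emeasurable_funM => //; apply/measurable_EFinP.
  exact: measurable_inv_loggamma_pdf.
- by move=> r; rewrite mule_ge0// lee_fin inv_loggamma_pdf_ge0.
apply: eq_integral => u; rewrite inE/= in_itv/= andbT => u0.
have sqrt_exp : Num.sqrt (expR (- u)) = expR (- u / 2).
  by rewrite -powR12_sqrt ?expR_ge0// -expRM.
have sqrt_v : Num.sqrt (v (expR (- u))) = sg * Num.sqrt (s * (1 - expR (- u))).
  rewrite /v /sg -sqrtrM; last by rewrite divr_ge0 ?ltW.
  by congr Num.sqrt; field; rewrite gt_eqF.
rewrite -muleA -EFinM; congr (_ * _%:E)%E.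
  by rewrite /K /m sqrt_exp sqrt_v.
rewrite /inv_loggamma_pdf expRK opprK -!mulrA; congr (_ * (_ * (_ * _))).
(* The Jacobian e^(-u) raises the exponent b - 1 of r to b. *)
by rewrite -expRM -expRD; congr expR; ring.
Qed.

End transition_formula.

Lemma integral_cst_probability d (T : measurableType d) (R : realType)
    (P : probability T R) (k : R) : (\int[P]_z k%:E = k%:E)%E.
Proof. by rewrite integral_cst//= probability_setT mule1. Qed.

Section gamma_density.
Context {R : realType}.
Local Notation mu := (@lebesgue_measure R).
Local Notation D := (`]0%R, +oo[%classic : set R).

Lemma integrable_gamma_integrand (b p : R) : 0 < b -> 0 < p ->
  mu.-integrable D (fun u => (u `^ (p - 1) * expR (- (b * u)))%:E).
Proof.
move=> b0 p0; apply/integrableP; split.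
  by apply/measurable_EFinP; exact: measurable_gamma_integrand.
under eq_integral do rewrite gee0_abs ?lee_fin ?mulr_ge0 ?powR_ge0 ?expR_ge0//.
by rewrite integral_gamma// ltry.
Qed.

Definition gamma_density (b h u : R) : R :=
  b `^ h / Gamma h * (u `^ (h - 1) * expR (- (b * u))).

Lemma gamma_density_ge0 (b h u : R) : 0 < h -> 0 <= gamma_density b h u.
Proof.
move=> h0; rewrite /gamma_density mulr_ge0// ?divr_ge0 ?mulr_ge0 ?powR_ge0 ?expR_ge0//.
by rewrite ltW// Gamma_gt0.
Qed.

Lemma measurable_gamma_density (b h : R) (A : set R) :
  measurable_fun A (gamma_density b h).
Proof. by apply: measurable_funM => //; exact: measurable_gamma_integrand. Qed.

Lemma integral_gamma_density (b h : R) : 0 < b -> 0 < h ->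
  (\int[mu]_(u in D) (gamma_density b h u)%:E = 1)%E.
Proof.
move=> b0 h0; under eq_integral do rewrite EFinM.
rewrite integralZl//; last exact: integrable_gamma_integrand.
rewrite integral_gamma// -EFinM powRN; congr EFin; field.
by rewrite !gt_eqF ?Gamma_gt0// powR_gt0.
Qed.

Lemma integrable_gamma_density (b h : R) : 0 < b -> 0 < h ->
  mu.-integrable D (fun u => (gamma_density b h u)%:E).
Proof.
move=> b0 h0; apply/integrableP; split.
  by apply/measurable_EFinP; exact: measurable_gamma_density.
under eq_integral do rewrite gee0_abs ?lee_fin ?gamma_density_ge0//.
by rewrite integral_gamma_density// ltry.
Qed.

End gamma_density.

Section kernel.
Context {R : realType} (f : R -> R) (M C : R).
Hypothesis f_bnd : forall y, `|f y| <= M.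
Hypothesis f_lip : forall y z, `|f y - f z| <= C * `|y - z|.
Variables (s x : R).
Hypothesis s_gt0 : 0 < s.
Local Notation mu := (@lebesgue_measure R).
Local Notation D := (`]0%R, +oo[%classic : set R).

(** The function F (sg, u) of the overview. *)
Definition jump_mean (sg u : R) : R :=
  gauss_smooth f (sg * expR (- u / 2) * x) (sg * Num.sqrt (s * (1 - expR (- u)))).

Lemma continuous_jump_scale : continuous (fun u : R => Num.sqrt (s * (1 - expR (- u)))).
Proof.
move=> u; apply: continuous_cvg; first exact: sqrt_continuous.
apply: cvgM; first exact: cvg_cst.
apply: (@cvgB _ R^o); first exact: cvg_cst.
apply: continuous_cvg; first exact: continuous_expR.
by apply: (@cvgN _ R^o); exact: cvg_id.
Qed.

Lemma continuous_jump_mean sg : continuous (jump_mean sg).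
Proof.
move=> u; apply: (cvg_gauss_smooth f_bnd f_lip).
  apply: cvgM; last exact: cvg_cst.
  apply: cvgM; first exact: cvg_cst.
  apply: continuous_cvg; first exact: continuous_expR.
  by apply: cvgM; [apply: (@cvgN _ R^o); exact: cvg_id|exact: cvg_cst].
by apply: cvgM; [exact: cvg_cst|exact: continuous_jump_scale].
Qed.

Lemma measurable_jump_mean sg (A : set R) : measurable_fun A (jump_mean sg).
Proof.
apply: measurable_funTS; apply: continuous_measurable_fun.
exact: continuous_jump_mean.
Qed.

Lemma jump_mean_bnd sg u : `|jump_mean sg u| <= M.
Proof.
apply: le_trans (le_normr_Rintegral _ _) _ => //.
  exact: (integrable_gauss_smooth f_bnd f_lip).
rewrite -[leRHS](_ : \int[normal_prob 0 1]_z (cst M z) = M); last first.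
  by rewrite Rintegral_cst//= probability_setT mulr1.
apply: le_Rintegral => //.
- by apply: integrable_norm => //; exact: (integrable_gauss_smooth f_bnd f_lip).
- exact: finite_measure_integrable_cst.
Qed.

(** The transition law and the gamma density both have mass 1, so any constant can be moved through
    the mixture formula. This serves twice: to pass from [f + M] back to [f], and to centre at [c],
    later taken to be [f (sg * x)]. *)
Lemma transition_Rintegral (a b t c : R) : 0 < a -> 0 < b -> s < t ->
  let sg := Num.sqrt (t / s) in
  \int[transition (inv_loggamma a b) s t x]_y f y - c =
  \int[mu]_(u in D) ((jump_mean sg u - c) * gamma_density b (a * ln sg) u).
Proof.
move=> a0 b0 st sg; set P := transition _ _ _ _; set h := a * ln sg.
have t0 : 0 < t := lt_trans s_gt0 st.
have sg1 : 1 < sg.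
  by rewrite /sg -(sqrtr1 R) ltr_sqrt ?divr_gt0// ltr_pdivlMr// mul1r.
have h0 : 0 < h by rewrite mulr_gt0// ln_gt0.
have mf : measurable_fun setT f := lipschitz_measurable f_lip.
(* The mixture formula for the constant 1 reduces the total mass to that of the gamma density. *)
have PT : (P setT = 1)%E.
  have <- : (\int[P]_y (cst 1 y)%:E = P setT)%E.
    by rewrite (integral_cst P measurableT 1) mul1e.
  rewrite (@ge0_integral_transition R a b s t x (cst 1) s_gt0 st)//.
  rewrite -[RHS](integral_gamma_density b0 h0); apply: eq_integral => u _.
  by rewrite (integral_cst_probability (normal_prob 0 1)) !mul1e.
have iP (k : R) : P.-integrable setT (EFin \o cst k).
  apply/integrableP; split => //=; first exact/measurable_EFinP.
  by rewrite (integral_cst P measurableT `|k|%:E) PT mule1 ltry.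
have iPf : P.-integrable setT (EFin \o f).
  apply: le_integrable (iP M) => //; first exact/measurable_EFinP.
  by move=> y _ /=; rewrite lee_fin; apply: le_trans (f_bnd _) _; exact: ler_norm.
have idens := integrable_gamma_density b0 h0.
have iZdens k : mu.-integrable D (EFin \o (fun u => k * gamma_density b h u)).
  exact: (integrableZl _ k idens).
have ijump : mu.-integrable D (EFin \o (fun u => jump_mean sg u * gamma_density b h u)).
  apply: le_integrable (iZdens M) => //.
  - apply/measurable_EFinP; apply: measurable_funM.
      exact: measurable_jump_mean.
    exact: measurable_gamma_density.
  - move=> u _ /=; rewrite lee_fin !normrM ler_wpM2r//.
    by apply: le_trans (jump_mean_bnd _ _) _; exact: ler_norm.
have Rdens : \int[mu]_(u in D) gamma_density b h u = 1.
  by rewrite /Rintegral integral_gamma_density.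
have key : \int[P]_y f y = \int[mu]_(u in D) (jump_mean sg u * gamma_density b h u).
  apply: (@addIr _ M).
  rewrite -[X in _ + X = _](_ : \int[P]_y (cst M y) = M); last first.
    by rewrite Rintegral_cst//= PT mulr1.
  rewrite -(RintegralD measurableT iPf (iP M)).
  rewrite -[X in _ = _ + X]mulr1 -[in RHS]Rdens -RintegralZl//.
  rewrite -RintegralD//.
  congr fine.
  rewrite (@ge0_integral_transition R a b s t x (fun y => f y + M) s_gt0 st).
  - apply: eq_integral => u _; rewrite -mulrDl [in RHS]EFinM; congr (_ * _)%E.
    under eq_integral do rewrite EFinD.
    rewrite integralD//=; last 2 first.
    + exact: (integrable_gauss_smooth f_bnd f_lip).
    + exact: finite_measure_integrable_cst.
    rewrite (gauss_smooth_EFin f_bnd f_lip).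
    rewrite (integral_cst_probability (normal_prob 0 1)).
    by rewrite EFinD.
  - exact: measurable_funD.
  - by move=> y; rewrite -lerBlDr sub0r; have := f_bnd y; rewrite ler_norml => /andP[].
rewrite key -[X in _ - X]mulr1 -[in LHS]Rdens -RintegralZl//.
rewrite -RintegralB//.
by apply: eq_Rintegral => u _; rewrite mulrBl.
Qed.

End kernel.

(** * Limits as [t] decreases to [s] *)

(** The limit is tested along sequences decreasing to [s] or approaching it from the right in any
    way. Domination holds only near [s], hence the shift by [N]. *)
Lemma dominated_cvg_at_right d (T : measurableType d) (R : realType)
    (mu : {measure set T -> \bar R}) (D : set T) (s : R)
    (F : R -> T -> R) (F0 g : T -> R) :
  measurable D -> (forall t, measurable_fun D (F t)) -> measurable_fun D F0 ->
  (forall u, D u -> F t u @[t --> s^'+] --> F0 u) ->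
  mu.-integrable D (EFin \o g) ->
  (\forall t \near s^'+, forall u, D u -> `|F t u| <= g u) ->
  \int[mu]_(u in D) F t u @[t --> s^'+] --> \int[mu]_(u in D) F0 u.
Proof.
move=> mD mF mF0 FF0 ig Fg; apply/cvg_at_rightP => v [vs v_cvg].
have vright : v n @[n --> \oo] --> s^'+.
  move=> A [e /= e0 Ae]; move/cvgrPdist_lt : v_cvg => /(_ _ e0).
  by apply: filterS => n vn; apply: Ae => //=; exact: vn.
have [N _ Ng] : \forall n \near \oo, forall u, D u -> `|F (v n) u| <= g u.
  exact: vright Fg.
have FN u : D u -> F (v (n + N)%N) u @[n --> \oo] --> F0 u.
  move=> Du; rewrite (cvg_shiftn N (fun n => F (v n) u)).
  exact: cvg_comp vright (FF0 _ Du).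
rewrite -(cvg_shiftn N).
have [] := @dominated_convergence _ T R mu D mD
  (fun n u => (F (v (n + N)%N) u)%:E) (EFin \o F0) (EFin \o g).
- by move=> n; exact/measurable_EFinP.
- exact/measurable_EFinP.
- by apply: aeW => u Du; apply: cvg_EFin; [exact: nearW|exact: FN].
- exact: ig.
- by apply: aeW => u n Du; rewrite /= lee_fin; apply: Ng => //=; exact: leq_addl.
move=> iF0 _ h; apply: fine_cvg; rewrite fineK//.
by apply: integrable_fin_num.
Qed.

Lemma cvg_at_right_difference_quotient (R : realType) (G : R -> R) (s d : R) :
  is_derive s 1 G d -> (t - s)^-1 * (G t - G s) @[t --> s^'+] --> d.
Proof.
move=> [dG <-].
have h : t - s @[t --> s^'+] --> (0 : R)^'.
  move=> A [e /= e0 Ae]; exists e => //= t ts st; apply: Ae => /=.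
    by rewrite sub0r normrN distrC.
  by rewrite subr_eq0 gt_eqF.
have := cvg_comp _ _ h dG; apply: cvg_trans.
apply: near_eq_cvg; near=> t => /=.
by rewrite /GRing.scale/= mulr1 subrK.
Unshelve. all: by end_near. Qed.

Section scaling.
Context {R : realType} (s : R).
Hypothesis s_gt0 : 0 < s.

Lemma is_derive_sqrt_ratio : is_derive s 1 (fun t => Num.sqrt (t / s)) (2 * s)^-1.
Proof.
have dd : is_derive s 1 (fun t : R => t / s) s^-1.
  have := is_deriveM (is_derive_id s 1) (is_derive_cst s^-1 s 1).
  by rewrite scaler0 add0r /GRing.scale/= mulr1; exact.
have d1 : is_derive (s / s) 1 Num.sqrt (2 * Num.sqrt (s / s))^-1.
  by apply: is_derive1_sqrt; rewrite divr_gt0.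
have := @is_derive1_comp _ Num.sqrt (fun t => t / s) s _ _ d1 dd.
by rewrite mulfV ?gt_eqF// sqrtr1 mulr1 -invfM; exact.
Qed.

Lemma cvg_sqrt_ratio : Num.sqrt (t / s) @[t --> s^'+] --> (1 : R).
Proof.
have <- : Num.sqrt (s / s) = 1 by rewrite mulfV ?gt_eqF// sqrtr1.
apply: cvg_at_right_filter.
apply: continuous_cvg; first exact: sqrt_continuous.
by apply: cvgM; [exact: cvg_id|exact: cvg_cst].
Qed.

(** The gamma shape vanishes at t = s, so its quotient by t - s tends to its derivative there. *)
Lemma cvg_ln_sqrt_ratio a :
  (t - s)^-1 * (a * ln (Num.sqrt (t / s))) @[t --> s^'+] --> a / (2 * s).
Proof.
pose G (t : R) := a * ln (Num.sqrt (t / s)).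
have Gs : G s = 0 by rewrite /G mulfV ?gt_eqF// sqrtr1 ln1 mulr0.
have dG : is_derive s 1 G (a / (2 * s)).
  have sq1 : Num.sqrt (s / s) = 1 by rewrite mulfV ?gt_eqF// sqrtr1.
  have dl : is_derive (Num.sqrt (s / s)) 1 (@ln R) (Num.sqrt (s / s))^-1.
    by apply: is_derive1_ln; rewrite sq1.
  have := is_deriveM (is_derive_cst a s 1) 
    (@is_derive1_comp _ (@ln R) (fun t => Num.sqrt (t / s)) s _ _ dl
      is_derive_sqrt_ratio).
  by rewrite scaler0 addr0 /GRing.scale/= sq1 invr1 mul1r; exact.
have := cvg_at_right_difference_quotient dG.
by rewrite Gs; under eq_fun do rewrite subr0.
Qed.

Lemma sqrt_ratio_gt1 t : s < t -> 1 < Num.sqrt (t / s).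
Proof.
move=> st; rewrite -(sqrtr1 R) ltr_sqrt ?divr_gt0//; last exact: lt_trans st.
by rewrite ltr_pdivlMr// mul1r.
Qed.

(** The target filter is one-sided so that the limit composes with [cvg_mulGamma0]. *)
Lemma cvg_ln_sqrt_ratio0 a : 0 < a ->
  a * ln (Num.sqrt (t / s)) @[t --> s^'+] --> (0 : R)^'+.
Proof.
move=> a0.
have h : a * ln (Num.sqrt (t / s)) @[t --> s^'+] --> (0 : R).
  rewrite -(mulr0 a); apply: cvgM; first exact: cvg_cst.
  rewrite -ln1; apply: (@continuous_cvg _ _ _ _ _ _ (@ln R)).
    by apply: continuous_ln.
  exact: cvg_sqrt_ratio.
move=> A [e /= e0 Ae]; move/cvgrPdist_lt : h => /(_ _ e0) h.
apply: filterS2 h (nbhs_right_gt s) => t ht st; apply: Ae => //=.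
by rewrite mulr_gt0// ln_gt0// sqrt_ratio_gt1.
Qed.

End scaling.

(** * Elementary bounds for small jumps *)

Section small_jump_bounds.
Context {R : realType}.
Implicit Types u : R.

Lemma sqrt1BexpRN_le u : 0 < u -> Num.sqrt (1 - expR (- u)) <= u `^ 2^-1.
Proof.
move=> u0; rewrite powR12_sqrt; last exact: ltW.
by apply: ler_wsqrtr; have := expR_ge1Dx (- u); lra.
Qed.

(** For y = e^(-u/2) in [0, 1], (1 - y)^2 <= 1 - y^2. Giving the mean the same rate as the standard
    deviation lets one constant, [jump_const], serve for both. *)
Lemma norm_expRN2B1_le u : 0 < u -> `|expR (- u / 2) - 1| <= u `^ 2^-1.
Proof.
move=> u0; apply: le_trans (sqrt1BexpRN_le u0).
have e1 : expR (- u / 2) <= 1 by rewrite expR_le1; lra.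
have e0 : 0 <= expR (- u / 2) := expR_ge0 _.
have -> : expR (- u) = expR (- u / 2) ^+ 2.
  by rewrite expr2 -expRD; congr expR; field.
rewrite distrC -sqrtr_sqr.
by apply: ler_wsqrtr; nra.
Qed.

(** The first summand dominates for u <= 1, the second for u >= 1. The bound is free of [h], as a
    dominating function must be when [h] varies with t. *)
Lemma powR_sub1_le h u : 0 < u -> 0 <= h -> h <= 1 -> u `^ (h - 1) <= u `^ (-1) + 1.
Proof.
move=> u0 h0 h1; have [u1|u1] := leP u 1.
  apply: (@le_trans _ _ (u `^ (-1))); last by rewrite lerDl.
  by apply: ger_powR; [rewrite u0 u1|rewrite lerBrDr addNr].
apply: (@le_trans _ _ 1); last by rewrite lerDr powR_ge0.
by rewrite -[leRHS](powRr0 u); apply: ler_powR; [exact: ltW|rewrite subr_le0].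
Qed.

End small_jump_bounds.

(** * Convergence of the difference quotient *)

Section generator_limit.
Context {R : realType} (f : R -> R) (M C : R).
Hypothesis f_bnd : forall y, `|f y| <= M.
Hypothesis f_lip : forall y z, `|f y - f z| <= C * `|y - z|.
Variables (b s x : R).
Hypothesis b_gt0 : 0 < b.
Hypothesis s_gt0 : 0 < s.
Local Notation mu := (@lebesgue_measure R).
Local Notation D := (`]0%R, +oo[%classic : set R).
Local Notation a := (loggamma_shape b).
Local Notation absmom := (\int[normal_prob (0 : R) 1]_z `|z|).
Local Notation jump_mean := (jump_mean f s x).

Let C0 : 0 <= C.
Proof. by have := f_lip 1 0; rewrite subr0 normr1 mulr1; exact: le_trans. Qed.

Let absmom_ge0 : 0 <= absmom.
Proof. exact: Rintegral_ge0. Qed.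

Let a0 : 0 < a. Proof. exact: loggamma_shape_gt0. Qed.

Definition jump_const : R := C * (`|x| + Num.sqrt s * absmom).

Lemma jump_const_ge0 : 0 <= jump_const.
Proof. by rewrite mulr_ge0// addr_ge0// mulr_ge0// sqrtr_ge0. Qed.

Lemma jump_bound u : 0 < u ->
  C * (`|(expR (- u / 2) - 1) * x| + `|Num.sqrt (s * (1 - expR (- u)))| * absmom)
  <= jump_const * u `^ 2^-1.
Proof.
move=> u0; rewrite /jump_const -[leRHS]mulrA; apply: ler_wpM2l => //.
rewrite [leRHS]mulrDl; apply: lerD.
  by rewrite normrM mulrC ler_wpM2l// norm_expRN2B1_le.
rewrite ger0_norm ?sqrtr_ge0// sqrtrM; last exact: ltW.
rewrite [leRHS]mulrAC; apply: ler_wpM2r => //; apply: ler_wpM2l; first exact: sqrtr_ge0.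
exact: sqrt1BexpRN_le.
Qed.

(** [f (sg * x)] is the Gaussian mean with standard deviation 0, so [gauss_smooth_lip] applies; both
    distances carry the factor [sg]. *)
Lemma jump_mean_sub_le sg u : 0 <= sg -> 0 < u ->
  `|jump_mean sg u - f (sg * x)| <= sg * jump_const * u `^ 2^-1.
Proof.
move=> sg0 u0; rewrite -[f _](gauss_smooth0 f).
apply: le_trans (gauss_smooth_lip f_bnd f_lip _ _ _ _) _.
rewrite -[leRHS]mulrA; apply: le_trans (ler_wpM2l sg0 (jump_bound u0)).
rewrite (_ : sg * _ * x - sg * x = sg * ((expR (- u / 2) - 1) * x)); last by ring.
rewrite subr0 !(normrM sg) (ger0_norm sg0) le_eqVlt; apply/orP; left; apply/eqP.
by ring.
Qed.

(** The gamma density of shape p without its normalization; this allows p = 0, which is the Lévy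
    density up to the factor [a]. *)
Let gint (p u : R) := u `^ (p - 1) * expR (- (b * u)).

(** The dominating function. The shapes 1/2 and 3/2 come from sqrt u (u^(-1) + 1), and the factor 2
    bounds [sg] for t near [s]. *)
Lemma integrable_small_jump : mu.-integrable D
  (EFin \o (fun u => 2 * jump_const * (gint 2^-1 u + gint (3 / 2) u))).
Proof.
have ig (p : R) : 0 < p -> mu.-integrable D (EFin \o gint p).
  by move=> p0; exact: integrable_gamma_integrand.
have i1 := ig 2^-1 ltac:(lra).
have i2 := ig (3 / 2) ltac:(lra).
exact: (integrableZl _ (2 * jump_const) (integrableD _ i1 i2)).
Qed.

Lemma measurable_jump_integrand sg c h (A : set R) :
  measurable_fun A (fun u => (jump_mean sg u - c) * gint h u).
Proof.
apply: measurable_funM; last exact: measurable_gamma_integrand.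
by apply: measurable_funB => //; exact: (measurable_jump_mean f_bnd f_lip).
Qed.

Lemma jump_integrand_le sg h u : 0 <= sg -> sg <= 2 -> 0 <= h -> h <= 1 -> 0 < u ->
  `|(jump_mean sg u - f (sg * x)) * gint h u| <=
  2 * jump_const * (gint 2^-1 u + gint (3 / 2) u).
Proof.
move=> sg0 sg2 h0 h1 u0.
have g0 : 0 <= gint h u by rewrite mulr_ge0 ?powR_ge0 ?expR_ge0.
rewrite normrM (ger0_norm g0).
apply: (@le_trans _ _ (2 * jump_const * u `^ 2^-1 *
    ((u `^ (-1) + 1) * expR (- (b * u))))).
  apply: ler_pM => //.
    apply: le_trans (jump_mean_sub_le sg0 u0) _.
    by rewrite ler_wpM2r ?powR_ge0// ler_wpM2r// jump_const_ge0.
  by rewrite ler_wpM2r ?expR_ge0// powR_sub1_le.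
rewrite le_eqVlt; apply/orP; left; apply/eqP.
rewrite /gint (_ : 3 / 2 - 1 = 2^-1); last by field.
rewrite [u `^ (2^-1 - 1)]powRD; last by apply/implyP => _; rewrite gt_eqF.
by ring.
Qed.

Lemma integrable_jump_integrand sg h : 0 <= sg -> sg <= 2 -> 0 <= h -> h <= 1 ->
  mu.-integrable D
    (EFin \o (fun u => (jump_mean sg u - f (sg * x)) * gint h u)).
Proof.
move=> sg0 sg2 h0 h1; apply: le_integrable integrable_small_jump => //.
  by apply/measurable_EFinP; exact: measurable_jump_integrand.
move=> u; rewrite /= in_itv/= andbT => u0; rewrite lee_fin.
apply: le_trans (jump_integrand_le sg0 sg2 h0 h1 u0) _; exact: ler_norm.
Qed.

Local Notation sg t := (Num.sqrt (t / s)).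

Lemma cvg_jump_integral :
  \int[mu]_(u in D) ((jump_mean (sg t) u - f (sg t * x)) * gint (a * ln (sg t)) u)
    @[t --> s^'+] -->
  \int[mu]_(u in D) ((jump_mean 1 u - f (1 * x)) * gint 0 u).
Proof.
have sg1 : sg t @[t --> s^'+] --> (1 : R) := cvg_sqrt_ratio s_gt0.
have h0 : a * ln (sg t) @[t --> s^'+] --> (0 : R).
  exact: cvg_trans (cvg_ln_sqrt_ratio0 s_gt0 a0) (@cvg_within _ _ _ _).
apply: (@dominated_cvg_at_right _ _ R mu D s _ _
  (fun u => 2 * jump_const * (gint 2^-1 u + gint (3 / 2) u))) => //.
- by move=> t; exact: measurable_jump_integrand.
- exact: measurable_jump_integrand.
- move=> u; rewrite /= in_itv/= andbT => u0; apply: cvgM.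
    apply: (@cvgB _ R^o).
      apply: (cvg_gauss_smooth f_bnd f_lip).
        by apply: cvgM; [apply: cvgM => //; exact: cvg_cst|exact: cvg_cst].
      by apply: cvgM => //; exact: cvg_cst.
    (* The centring point also moves with t; it is treated as a Gaussian mean with standard
       deviation 0. *)
    rewrite -(gauss_smooth0 f).
    under eq_fun do rewrite -(gauss_smooth0 f).
    apply: (cvg_gauss_smooth f_bnd f_lip); last exact: cvg_cst.
    by apply: cvgM => //; exact: cvg_cst.
  apply: cvgM; last exact: cvg_cst.
  rewrite /powR gt_eqF//.
  apply: continuous_cvg; first exact: continuous_expR.
  apply: cvgM; last exact: cvg_cst.
  by apply: (@cvgB _ R^o) => //; exact: cvg_cst.
- exact: integrable_small_jump.
- near=> t => u; rewrite /= in_itv/= andbT => u0.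
  have st : s < t by near: t; exact: nbhs_right_gt.
  have sgt1 := sqrt_ratio_gt1 s_gt0 st.
  apply: jump_integrand_le => //.
  + by near: t; apply: cvgr_le sg1 _ _; rewrite ltr1n.
  + by rewrite mulr_ge0 ?ltW// ln_gt0.
  + by near: t; apply: cvgr_le h0 _ _; exact: ltr01.
Unshelve. all: by end_near. Qed.

Lemma cvg_generator_quotient (f'x : R) : is_derive x 1 f f'x ->
  generator_quotient (transition (inv_loggamma a b)) s f x t @[t --> s^'+] -->
  x / (2 * s) * f'x +
  (2 * s)^-1 * \int[mu]_(u in D) ((jump_mean 1 u - f x) * levy_pdf b u).
Proof.
move=> df.
pose J t := \int[mu]_(u in D)
  ((jump_mean (sg t) u - f (sg t * x)) * gint (a * ln (sg t)) u).
pose h t := a * ln (sg t).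
have h0 := cvg_ln_sqrt_ratio0 s_gt0 a0.
have lim_drift : (t - s)^-1 * (f (sg t * x) - f x) @[t --> s^'+] --> x / (2 * s) * f'x.
  have sgs : sg s = 1 by rewrite mulfV ?gt_eqF// sqrtr1.
  have d2 : is_derive s 1 (fun t => sg t * x) (x / (2 * s)).
    have := is_deriveM (is_derive_sqrt_ratio s_gt0) (is_derive_cst x s 1).
    by rewrite scaler0 add0r /GRing.scale/=; exact.
  have d1 : is_derive (sg s * x) 1 f f'x by rewrite sgs mul1r.
  have := cvg_at_right_difference_quotient
    (@is_derive1_comp _ f (fun t => sg t * x) s _ _ d1 d2).
  by rewrite /= sgs mul1r [f'x * _]mulrC.
(* The normalization b^h / Gamma(h) over t - s is expanded by h, so that each factor has a finite
   limit. *)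
have lim_jump : b `^ (h t) * ((t - s)^-1 * h t) / (h t * Gamma (h t)) * J t
    @[t --> s^'+] --> 1 * (a / (2 * s)) / 1 *
      \int[mu]_(u in D) ((jump_mean 1 u - f (1 * x)) * gint 0 u).
  apply: cvgM; last exact: cvg_jump_integral.
  apply: cvgM.
    apply: cvgM; last exact: cvg_ln_sqrt_ratio.
    rewrite /powR gt_eqF//.
    rewrite -[X in _ --> X]expR0; apply: continuous_cvg; first exact: continuous_expR.
    rewrite -(mul0r (ln b)); apply: cvgM; last exact: cvg_cst.
    exact: cvg_trans h0 (@cvg_within _ _ _ _).
  apply: cvgV; first exact: oner_neq0.
  exact: (cvg_comp _ _ h0 cvg_mulGamma0).
have -> : (2 * s)^-1 * \int[mu]_(u in D) ((jump_mean 1 u - f x) * levy_pdf b u) =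
    1 * (a / (2 * s)) / 1 *
      \int[mu]_(u in D) ((jump_mean 1 u - f (1 * x)) * gint 0 u).
  rewrite mul1r divr1 [a / _]mulrC -mulrA -RintegralZl//; last first.
    by apply: integrable_jump_integrand => //; rewrite ler1n.
  congr (_ * _); apply: eq_Rintegral => u; rewrite inE/= in_itv/= andbT => u0.
  rewrite /gint sub0r powR_inv1; last exact: ltW.
  by rewrite /levy_pdf mul1r; ring.
apply: cvg_trans (@cvgD _ R^o _ _ _ _ _ _ _ lim_drift lim_jump).
(* The decomposition is an identity only for t > s close to [s]: h <= 1 and sg <= 2 ensure the
   integrability that lets the normalization out of the integral. *)
apply: near_eq_cvg; near=> t => /=.
have st : s < t by near: t; exact: nbhs_right_gt.
have sgt1 := sqrt_ratio_gt1 s_gt0 st.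
have ht : 0 < h t by rewrite mulr_gt0// ln_gt0.
have ht1 : h t <= 1.
  near: t; apply: cvgr_le (cvg_trans h0 (@cvg_within _ _ _ _)) _ _; exact: ltr01.
have sg2 : sg t <= 2.
  by near: t; apply: cvgr_le (cvg_sqrt_ratio s_gt0) _ _; rewrite ltr1n.
rewrite /generator_quotient.
rewrite (_ : _ - f x = (\int[transition (inv_loggamma a b) s t x]_y f y - f (sg t * x))
  + (f (sg t * x) - f x)); last by ring.
rewrite (transition_Rintegral f_bnd f_lip)// mulrDr addrC; congr (_ + _).
under [in RHS]eq_Rintegral do rewrite /gamma_density mulrCA.
rewrite RintegralZl//; last first.
  by apply: integrable_jump_integrand => //; exact: ltW.
rewrite [in RHS]mulrA -/(h t) -/(J t); congr (_ * _); field.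
by rewrite !gt_eqF ?Gamma_gt0 ?subr_gt0.
Unshelve. all: by end_near. Qed.

End generator_limit.

(** * The jump part of the generator *)

(* The integral may be [+oo] while [c] is negative: the inner integral of the
   jump part need not converge at [y = 0]. *)
Lemma ge0_integralZl_real d (T : measurableType d) (R : realType)
    (mu : {measure set T -> \bar R}) (D : set T) (g : T -> \bar R) (c : R) :
  measurable D -> measurable_fun D g -> (forall u, D u -> 0 <= g u)%E ->
  (c%:E * \int[mu]_(u in D) g u = \int[mu]_(u in D) (c%:E * g u))%E.
Proof.
move=> mD mg g0; have [c0|c0] := leP 0 c.
  by rewrite ge0_integralZl// lee_fin.
rewrite -[c]opprK EFinN mulNe -ge0_integralZl//; last first.
  by rewrite lee_fin oppr_ge0 ltW.
rewrite -integral_ge0N; last first.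
  by move=> u Du; rewrite mule_ge0 ?g0// lee_fin oppr_ge0 ltW.
by apply: eq_integral => u _; rewrite mulNe.
Qed.

Section generator_jump_part.
Context {R : realType} (f : R -> R) (M C : R).
Hypothesis f_bnd : forall y, `|f y| <= M.
Hypothesis f_lip : forall y z, `|f y - f z| <= C * `|y - z|.
Variables (b s x : R).
Hypothesis b_gt0 : 0 < b.
Hypothesis s_gt0 : 0 < s.
Local Notation mu := (@lebesgue_measure R).
Local Notation D := (`]0%R, +oo[%classic : set R).
Local Notation a := (loggamma_shape b).
Local Notation jump_mean := (jump_mean f s x).

Let mf : measurable_fun setT f := lipschitz_measurable f_lip.

Let mshift : measurable_fun setT (fun y => f (x + y)).
Proof. by apply: (measurableT_comp mf); exact: measurable_funD. Qed.

(** f (x + y) - f x is split into f (x + y) + M and M + f x: the first is nonnegative, so the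
    passage to the standard normal applies, and the second is constant. *)
Lemma integral_gauss_density_sub (m v : R) : 0 < v ->
  (\int[mu]_y ((f (x + y) - f x) * gauss_density m v y)%:E =
   (gauss_smooth f (x + m) (Num.sqrt v) - f x)%:E)%E.
Proof.
move=> v0.
have igauss : mu.-integrable setT (EFin \o gauss_density m v).
  exact: integrable_normal_pdf.
have mgauss : measurable_fun setT (gauss_density m v).
  exact: measurable_normal_pdf.
have gauss_ge0 y : 0 <= gauss_density m v y by exact: normal_pdf_ge0.
have pos y : 0 <= f (x + y) + M.
  by rewrite -lerBlDr sub0r; have := f_bnd (x + y); rewrite ler_norml => /andP[].
have E1 : (\int[mu]_y ((f (x + y) + M) * gauss_density m v y)%:E =
   (gauss_smooth f (x + m) (Num.sqrt v) + M)%:E)%E.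
  rewrite (ge0_integral_gauss_density (f := fun y => f (x + y) + M))//; last first.
    exact: measurable_funD.
  under eq_integral do rewrite EFinD addrA.
  rewrite integralD//=; last 2 first.
  - exact: (integrable_gauss_smooth f_bnd f_lip).
  - exact: finite_measure_integrable_cst.
  rewrite (gauss_smooth_EFin f_bnd f_lip).
  by rewrite (integral_cst_probability (normal_prob 0 1)).
have i1 : mu.-integrable setT (EFin \o (fun y => (f (x + y) + M) * gauss_density m v y)).
  apply/integrableP; split.
    by apply/measurable_EFinP; apply: measurable_funM => //; exact: measurable_funD.
  under eq_integral do rewrite /= ger0_norm ?mulr_ge0//.
  by rewrite E1 ltry.
have i2 := integrableZl measurableT (M + f x) igauss.
transitivity (\int[mu]_y (((f (x + y) + M) * gauss_density m v y)%:E -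
    ((M + f x)%:E * (gauss_density m v y)%:E)))%E.
  by apply: eq_integral => y _; rewrite -EFinM -EFinB; congr EFin; ring.
rewrite integralB// E1 integralZl// integral_normal_pdf mule1 -EFinB.
by congr EFin; ring.
Qed.

Lemma integral_gauss_density_dist_le (m v : R) : 0 < v ->
  (\int[mu]_y (`|f (x + y) - f x| * gauss_density m v y)%:E <=
   (C * (`|m| + `|Num.sqrt v| * \int[normal_prob (0 : R) 1]_z `|z|))%:E)%E.
Proof.
move=> v0.
rewrite (ge0_integral_gauss_density (f := fun y => `|f (x + y) - f x|))//;
  last first.
  by apply: measurableT_comp => //; exact: measurable_funB.
rewrite -gauss_lip_EFin; apply: ge0_le_integral => //.
- apply/measurable_EFinP; apply: measurableT_comp => //.
  apply: measurable_funB => //; apply: (measurableT_comp mshift).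
  by apply: measurable_funD => //; exact: measurable_funM.
- exact: measurable_int (integrable_gauss_lip C m (Num.sqrt v)).
- move=> z _; rewrite lee_fin; apply: le_trans (f_lip _ _) _.
  have C0 : 0 <= C.
    by have := f_lip 1 0; rewrite subr0 normr1 mulr1; exact: le_trans.
  rewrite ler_wpM2l// addrC addKr -normrM.
  exact: ler_normD.
Qed.

Let jm (w : R) := (expR (- w / 2) - 1) * x.
Let jv (w : R) := s * (1 - expR (- w)).

Let mexp (c : R) : measurable_fun setT (fun w : R => expR (- w / c)).
Proof. by apply: measurableT_comp => //; exact: measurable_funM. Qed.

Let mjm : measurable_fun setT jm.
Proof. by apply: measurable_funM => //; exact: measurable_funB. Qed.

Let mjv : measurable_fun setT jv.
Proof.
apply: measurable_funM => //; apply: measurable_funB => //.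
exact: measurableT_comp.
Qed.

Let jv_gt0 w : 0 < w -> 0 < jv w.
Proof. by move=> w0; rewrite mulr_gt0// subr_gt0 expR_lt1 oppr_lt0. Qed.

(** Extended by zero to w <= 0, so that both integrals run over the whole line, as in Fubini's
    theorem for [mu \x mu]. *)
Let jump_kernel (yw : measurableTypeR R * measurableTypeR R) : \bar R :=
  ((fun w => ((f (x + yw.1) - f x) * gauss_density (jm w) (jv w) yw.1
     * levy_pdf b w)%:E) \_ D) yw.2.

Let jump_kernelE y w : 0 < w ->
  jump_kernel (y, w) =
  ((f (x + y) - f x) * gauss_density (jm w) (jv w) y * levy_pdf b w)%:E.
Proof.
by move=> w0; rewrite /jump_kernel patchE mem_set//= in_itv/= andbT.
Qed.

Let jump_kernel0 y w : w <= 0 -> jump_kernel (y, w) = 0%E.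
Proof.
move=> w0; rewrite /jump_kernel patchE memNset//= in_itv/= andbT.
by apply/negP; rewrite -leNgt.
Qed.

Let measurable_jump_kernel : measurable_fun setT jump_kernel.
Proof.
pose A : set (measurableTypeR R * measurableTypeR R) := setT `*` D.
have mA : measurable A by exact: measurableX.
have -> : jump_kernel = (fun yw => ((f (x + yw.1) - f x) *
    gauss_density (jm yw.2) (jv yw.2) yw.1)%:E * (((EFin \o levy_pdf b) \_ D) yw.2))%E.
  apply/funext => -[y w]; have [w0|w0] := leP w 0.
    rewrite jump_kernel0// patchE memNset ?mule0//= in_itv/= andbT.
    by apply/negP; rewrite -leNgt.
  by rewrite jump_kernelE// patchE mem_set ?EFinM//= in_itv/= andbT.
apply: emeasurable_funM.
  apply/measurable_EFinP; apply: measurable_funM.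
    by apply: measurable_funB => //; exact: (measurableT_comp mshift).
  by apply: measurable_gauss_density => //; exact: measurableT_comp.
apply: measurableT_comp => //.
by apply: measurable_restrict_pdf => //; exact: measurable_levy_pdf.
Qed.

Let levy_ge0 w : 0 < w -> 0 <= levy_pdf b w.
Proof. exact: levy_pdf_ge0. Qed.

Lemma integrable_gauss_density_sub (m v : R) : 0 < v ->
  mu.-integrable setT
    (EFin \o (fun y => (f (x + y) - f x) * gauss_density m v y)).
Proof.
move=> v0; apply/integrableP; split.
  apply/measurable_EFinP; apply: measurable_funM; first exact: measurable_funB.
  exact: measurable_normal_pdf.
apply: le_lt_trans (ltry _); apply: le_trans (integral_gauss_density_dist_le m v0).
under eq_integral => y _.
  rewrite /= normrM [X in _ * X]ger0_norm; last exact: normal_pdf_ge0.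
  over.
exact: lexx.
Qed.

Let integral_jump_kernel w : 0 < w ->
  (\int[mu]_y jump_kernel (y, w) =
   ((jump_mean 1 w - f x) * levy_pdf b w)%:E)%E.
Proof.
move=> w0; under eq_integral do rewrite jump_kernelE// EFinM.
rewrite integralZr//; last exact: (integrable_gauss_density_sub (jm w) (jv_gt0 w0)).
rewrite integral_gauss_density_sub ?jv_gt0// -EFinM; congr ((_ - _) * _)%:E.
by rewrite /jump_mean !mul1r /jm; congr gauss_smooth; ring.
Qed.

(** The sqrt w of [jump_bound] against the w^(-1) of the Lévy density leaves a gamma integrand of
    shape 1/2. *)
Let integral_norm_jump_kernel_le w : 0 < w ->
  (\int[mu]_y `|jump_kernel (y, w)| <=
   (a * jump_const C s x * (w `^ (2^-1 - 1) * expR (- (b * w))))%:E)%E.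
Proof.
move=> w0; under eq_integral => y _.
  rewrite jump_kernelE// abse_EFin normrM (ger0_norm (levy_ge0 w0)) normrM.
  rewrite (ger0_norm (normal_pdf_ge0 _ _ _)) EFinM.
  over.
rewrite ge0_integralZr//; last 3 first.
- apply/measurable_EFinP; apply: measurable_funM; last exact: measurable_normal_pdf.
  by apply: measurableT_comp => //; exact: measurable_funB.
- by move=> y _; rewrite lee_fin mulr_ge0// normal_pdf_ge0.
- by rewrite lee_fin levy_ge0.
apply: (@le_trans _ _ ((jump_const C s x * w `^ 2^-1)%:E * (levy_pdf b w)%:E)%E).
  rewrite lee_wpmul2r ?lee_fin ?levy_ge0//.
  apply: le_trans (integral_gauss_density_dist_le _ (jv_gt0 w0)) _.
  by rewrite lee_fin; exact: (jump_bound f_lip x s_gt0 w0).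
rewrite -EFinM lee_fin le_eqVlt; apply/orP; left; apply/eqP.
rewrite powRB; last by apply/implyP => _; rewrite gt_eqF.
by rewrite powRr1 /levy_pdf ?(ltW w0)//; ring.
Qed.

Let integrable_jump_kernel : (mu \x mu)%E.-integrable setT jump_kernel.
Proof.
apply/integrable21ltyP => //.
pose g (w : R) : \bar R :=
  (a * jump_const C s x * (w `^ (2^-1 - 1) * expR (- (b * w))))%:E.
have a0 : 0 <= a by rewrite ltW// loggamma_shape_gt0.
have ig : mu.-integrable D g.
  have i0 : mu.-integrable D (fun w => (w `^ (2^-1 - 1) * expR (- (b * w)))%:E).
    by apply: integrable_gamma_integrand => //; rewrite invr_gt0.
  exact: (integrableZl _ (a * jump_const C s x) i0).
have g0 w : (0 <= g w)%E.
  rewrite lee_fin; apply: mulr_ge0; last by rewrite mulr_ge0 ?powR_ge0 ?expR_ge0.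
  by apply: mulr_ge0 => //; exact: (jump_const_ge0 f_lip).
apply: (@le_lt_trans _ _ (\int[mu]_(w in D) g w)%E); last first.
  have /integrableP[_] := ig; apply: le_lt_trans.
  by apply: ge0_le_integral => //;
    [exact: measurable_int ig|exact: measurableT_comp (measurable_int _ ig)|
     move=> w _; rewrite gee0_abs].
rewrite [leRHS]integral_mkcond; apply: ge0_le_integral => //.
- by move=> w _; apply: integral_ge0.
- apply: (@measurable_fun_fubini_tonelli_G _ _ _ _ _ mu
    (fun z => `|jump_kernel z|)%E) => //.
  exact: measurableT_comp.
- by apply: (measurable_restrictT _ _).1 => //; exact: measurable_int ig.
move=> w _; rewrite patchE; case: ifPn; rewrite ?notin_setE ?in_setE/= in_itv/= andbT.
  exact: integral_norm_jump_kernel_le.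
move=> /negP; rewrite -leNgt => w0.
by rewrite integral0_eq// => y _; rewrite jump_kernel0// abse0.
Qed.

Lemma integrable_jump_levy :
  mu.-integrable D (EFin \o (fun w => (jump_mean 1 w - f x) * levy_pdf b w)).
Proof.
have i0 := integrable_jump_integrand f_bnd f_lip x b_gt0 s_gt0 ler01
  (ler1n R 2) (lexx 0) ler01.
apply: eq_integrable (integrableZl _ a i0) => // w.
rewrite inE/= in_itv/= andbT => w0.
rewrite -EFinM mul1r sub0r powR_inv1; last exact: ltW.
by congr EFin; rewrite /levy_pdf; ring.
Qed.

(** The increment of [f] enters the Lévy integral before the order is exchanged: the Gaussian
    density alone can have an infinite Lévy integral, whereas the product kernel is integrable. *)
Lemma generator_jump_partE :
  (\int[mu]_y ((f (x + y) - f x)%:E *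
     \int[levy_measure b_gt0]_(w in D) (gauss_density (jm w) (jv w) y)%:E) =
   (\int[mu]_(w in D) ((jump_mean 1 w - f x) * levy_pdf b w))%R%:E)%E.
Proof.
rewrite [RHS]fineK; last by apply: integrable_fin_num => //; exact: integrable_jump_levy.
transitivity (\int[mu]_y \int[mu]_w jump_kernel (y, w))%E.
  apply: eq_integral => y _.
  have mg : measurable_fun D (fun w => (gauss_density (jm w) (jv w) y)%:E).
    apply: measurable_funTS; apply/measurable_EFinP.
    by apply: measurable_gauss_density.
  rewrite (@ge0_integral_density _ _ _ mu _ ((EFin \o levy_pdf b) \_ D))//; last 3 first.
  - by apply: restrict_pdf_ge0; exact: levy_pdf_ge0_itv.
  - by apply: measurable_restrict_pdf => //; exact: measurable_levy_pdf.
  - by move=> w _; rewrite lee_fin normal_pdf_ge0.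
  rewrite ge0_integralZl_real//; last 2 first.
  - apply: emeasurable_funM => //; apply: measurable_funTS.
    by apply: measurable_restrict_pdf => //; exact: measurable_levy_pdf.
  - move=> w Dw; rewrite mule_ge0//; first by rewrite lee_fin normal_pdf_ge0.
    by apply: restrict_pdf_ge0; exact: levy_pdf_ge0_itv.
  rewrite integral_mkcond; apply: eq_integral => w _.
  rewrite patchE; case: ifPn => [wD|]; last first.
    rewrite notin_setE/= in_itv/= andbT => /negP; rewrite -leNgt => w0.
    by rewrite jump_kernel0.
  move: (wD); rewrite inE/= in_itv/= andbT => w0.
  by rewrite jump_kernelE// patchE wD -!EFinM mulrA.
rewrite Fubini// [RHS]integral_mkcond; apply: eq_integral => w _.
rewrite patchE; case: ifPn; rewrite ?notin_setE ?in_setE/= in_itv/= andbT.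
  exact: integral_jump_kernel.
move=> /negP; rewrite -leNgt => w0.
by rewrite integral0_eq// => y _; rewrite jump_kernel0.
Qed.

End generator_jump_part.

(** * Bounded derivative, Lipschitz bound and conclusion *)

Lemma bounded_funE (R : realType) (g : R -> R) :
  bounded_fun g -> exists M, forall y, `|g y| <= M.
Proof.
move=> [r [_ /(_ (r + 1))]]; rewrite ltrDl => /(_ ltr01) h.
by exists (r + 1) => y; exact: h.
Qed.

Lemma bounded_derive_lipschitz (R : realType) (f : R -> R) (C : R) :
  (forall y, derivable f y 1) -> (forall y, `|(f^`())%classic y| <= C) ->
  forall y z, `|f y - f z| <= C * `|y - z|.
Proof.
move=> df fC.
have lt y z : y < z -> `|f z - f y| <= C * `|z - y|.
  move=> yz; have [||c _ ->] := @MVT R f (f^`())%classic y z yz.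
  - by move=> c _; apply: DeriveDef => //; rewrite derive1E.
  - apply: continuous_subspaceT => c.
    by apply: differentiable_continuous; apply/derivable1_diffP.
  - by rewrite normrM ler_wpM2r.
move=> y z; have [yz|zy|->] := ltgtP y z.
- by rewrite distrC [`|y - z|]distrC; exact: lt.
- exact: lt.
- by rewrite !subrr normr0 mulr0.
Qed.

Unset Implicit Arguments.

Theorem proposition13 (R : realType) (b : R) (b_gt0 : 0 < b)
    (f : R -> R) (f_diff : forall y : R, derivable f y 1)
    (f_bounded : bounded_fun f) (f'_bounded : bounded_fun (f^`())%classic)
    (s : R) (s_gt0 : 0 < s) (x : R) :
  let P := transition (inv_loggamma (loggamma_shape b) b) in
  let nu := levy_measure b_gt0 in
  cvg (generator_quotient P s f x t @[t --> s^'+]) /\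
  ((generator P s f x)%:E =
     (x / (2 * s) * (f^`())%classic x)%:E +
     ((2 * s)^-1)%:E *
     \int[lebesgue_measure]_(y in [set: R])
       ((f (x + y) - f x)%:E *
        \int[nu]_(w in `]0%R, +oo[)
          (gauss_density ((expR (- w / 2) - 1) * x)
             (s * (1 - expR (- w))) y)%:E))%E.
Proof.
move=> P nu.
have [M f_bnd] := bounded_funE f_bounded.
have [C f'_bnd] := bounded_funE f'_bounded.
have f_lip := bounded_derive_lipschitz f_diff f'_bnd.
have df : is_derive x 1 f ((f^`())%classic x).
  by apply: DeriveDef => //; rewrite derive1E.
have lim := cvg_generator_quotient f_bnd f_lip b_gt0 s_gt0 df.
split; first by apply/cvg_ex; eexists; exact: lim.
rewrite /generator (cvg_lim _ lim)// EFinD EFinM; congr (_ + _)%E.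
by rewrite EFinM; congr (_ * _)%E; rewrite (generator_jump_partE f_bnd f_lip).
Qed.
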